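(* Let $k \ge 3$ be odd and let $n \ge 1$. Every $k$-minimal $n$-vertex tree has exactly $f_k(n)$ $k$-MDISs. Furthermore, the following hold (trees being considered up to isomorphism): (i) If $1 \le n \le k+1$, all $n$-vertex trees are $k$-minimal. (ii) If $n \ge k+2$ and $\lfloor k/2\rfloor+1$ divides $n-1$, then $S_{p,\lfloor k/2\rfloor+1}$ is the only $k$-minimal $n$-vertex tree, where $p = \lfloor (n-1)/(\lfloor k/2\rfloor+1)\rfloor$. (iii) If $n \ge k+2$ and $\lfloor k/2\rfloor+1$ does not divide $n-1$, then $$\mathrm{Add}^*_k(S_{p,\lfloor k/2\rfloor+1}, r) \cup \mathrm{Add}_k(\mathcal{B}_{p,\lfloor k/2\rfloor+1}, r-1)$$ is the class of all $k$-minimal $n$-vertex trees, where $p = \lfloor (n-1)/(\lfloor k/2\rfloor+1)\rfloor$ and $r = (n-1) \bmod (\lfloor k/2\rfloor+1)$.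
   Context: Graphs are finite and simple. A set $J \subseteq V(G)$ is a distance-$k$ independent set if any two distinct vertices of $J$ are at distance at least $k+1$; a $k$-MDIS is an inclusion-wise maximal distance-$k$ independent set. An $n$-vertex tree is $k$-minimal if it has the minimum possible number of $k$-MDISs among all $n$-vertex trees. The function $f_k$: $f_k(n) = n$ if $n \le k+1$, and $f_k(n) = n - \left\lfloor \frac{n - (k \bmod 2)}{\lfloor k/2 \rfloor + 1} \right\rfloor + 1$ if $n \ge k+2$. An $m$-path is a path $P_m$ on $m$ vertices. $S_{p,m}$ is the $(pm+1)$-vertex tree obtained from $p$ disjoint copies of $P_m$ by adding a new vertex and joining it to one endvertex of each copy. For $p_1,p_2 \ge 1$, $B_{p_1,p_2,s}$ is the tree of diameter $2s+1$ with $(p_1+p_2)s+2$ vertices whose two (adjacent) central vertices are joined (each by an edge to an endvertex of the path) to $p_1$ and $p_2$ disjoint $s$-paths, respectively. $\mathcal{B}_{p,s}$ is the family of all trees $B_{p_1,p_2,s}$ with $p_1,p_2\ge 1$ and $p_1+p_2=p$. $N_k[v]$ is the set of vertices at distance at most $k$ from $v$. A vertex $u$ of a tree $T$ is a $k$-twin if there is $v \in V(T)\setminus\{u\}$ with $N_k[u]=N_k[v]$. A leaf is a vertex of degree 1; a diametral leaf is a leaf of maximum eccentricity among all leaves. A diametral $k$-twin is a diametral leaf that is a $k$-twin. A pair $(x,y)$ of vertices is $k$-special if $x$ and $y$ are diametral leaves that are both $k$-twins but $N_k[x] \ne N_k[y]$. For an $m$-vertex tree $T$ with no diametral $k$-twins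 and $r \ge 0$: $\mathrm{Add}_k(T,r)$ is the family of all $(m+r)$-vertex trees of diameter $\mathrm{diam}(T)$ that contain $T$ as a subgraph and do not contain diametral $k$-twins; $\mathrm{Add}^*_k(T,r)$ is the family of all $(m+r)$-vertex trees of diameter $\mathrm{diam}(T)$ that contain $T$ as a subgraph and do not contain $k$-special pairs. For a class of trees $\mathcal{T}$, $\mathrm{Add}_k(\mathcal{T},r) = \bigcup_{T\in\mathcal{T}} \mathrm{Add}_k(T,r)$. *)

(* Defs.v *)
From mathcomp Require Import all_boot.

Set Implicit Arguments.
Unset Strict Implicit.
Unset Printing Implicit Defensive.

Record sgraph := SGraph {
  vertex :> finType;
  adj : rel vertex;
  adj_sym : symmetric adj;
  adj_irrefl : irreflexive adj }.

Definition iso (G H : sgraph) : Prop :=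
  exists2 f : G -> H, bijective f & forall x y, adj (f x) (f y) = adj x y.

(* H contains a (not necessarily induced) subgraph isomorphic to G. *)
Definition subgraph (G H : sgraph) : Prop :=
  exists2 f : G -> H, injective f & forall x y, adj x y -> adj (f x) (f y).

Definition connected (G : sgraph) : Prop :=
  0 < #|G| /\ forall x y : G, connect (@adj G) x y.

(* ucycle also accepts the closed walk x, y, x along a single edge, hence the
   lower bound on the size. *)
Definition acyclic (G : sgraph) : Prop :=
  forall c : seq G, ucycle (@adj G) c -> size c <= 2.

Definition tree (G : sgraph) : Prop := connected G /\ acyclic G.

Section Distance.
Variable G : sgraph.
Implicit Types (x y u v : G) (J : {set G}) (k m : nat).

Definition walk m x y : bool :=
  [exists w : m.-tuple G, path (@adj G) x w && (last x w == y)].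

(* The least length of a walk from x to y. Distances in a connected graph are
   below #|G|; when y is not reachable from x the value is #|G|. *)
Definition dist x y : nat := find (fun m => walk m x y) (iota 0 #|G|).

Definition ecc x : nat := \max_(y : G) dist x y.

Definition diam : nat := \max_(x : G) ecc x.

Definition dist_indep k J : bool :=
  [forall x in J, forall y in J, (x != y) ==> (k.+1 <= dist x y)].

Definition MDIS k : {set {set G}} := [set J | maxset (dist_indep k) J].

Definition nbh k v : {set G} := [set w | dist v w <= k].

Definition leaf v : bool := #|[set w | adj v w]| == 1.

Definition diametral_leaf v : bool :=
  leaf v && [forall u, leaf u ==> (ecc u <= ecc v)].

Definition twin k u : bool := [exists v, (v != u) && (nbh k u == nbh k v)].

Definition diametral_twin k u : bool := diametral_leaf u && twin k u.

Definition special k x y : bool :=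
  [&& diametral_twin k x, diametral_twin k y & nbh k x != nbh k y].

End Distance.

Definition k_minimal k (G : sgraph) : Prop :=
  tree G /\ forall H : sgraph, tree H -> #|H| = #|G| -> #|MDIS G k| <= #|MDIS H k|.

Definition f_ k n : nat :=
  if n <= k.+1 then n else n - (n - k %% 2) %/ (k %/ 2 + 1) + 1.

Section Spider.
Variables p m : nat.

(* None is the centre; Some (i, j) is the j-th vertex of the i-th path, numbered
   from the endvertex joined to the centre. *)
Definition spider_adj : rel (option ('I_p * 'I_m)) := fun x y =>
  match x, y with
  | None, None => false
  | None, Some (_, j) | Some (_, j), None => j == 0 :> nat
  | Some (i, j), Some (i', j') => (i == i') && ((j.+1 == j') || (j'.+1 == j))
  end.

Lemma spider_adj_sym : symmetric spider_adj.
Proof. by move=> [[i j]|] [[i' j']|] //=; rewrite eq_sym orbC. Qed.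

Lemma spider_adj_irrefl : irreflexive spider_adj.
Proof. by move=> [[i j]|] //=; rewrite eqxx eqn_leq ltnn. Qed.

Definition S_ : sgraph := SGraph spider_adj_sym spider_adj_irrefl.

End Spider.

Section DoubleSpider.
Variables p1 p2 s : nat.

(* Two disjoint spiders S_ p1 s and S_ p2 s whose centres are joined by an edge. *)
Definition dspider_adj : rel (S_ p1 s + S_ p2 s)%type := fun x y =>
  match x, y with
  | inl a, inl b => adj a b
  | inr a, inr b => adj a b
  | inl a, inr b | inr b, inl a => (a == None) && (b == None)
  end.

Lemma dspider_adj_sym : symmetric dspider_adj.
Proof. by move=> [a|a] [b|b] //; apply: adj_sym. Qed.

Lemma dspider_adj_irrefl : irreflexive dspider_adj.
Proof. by move=> [a|a]; apply: adj_irrefl. Qed.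

Definition B_ : sgraph := SGraph dspider_adj_sym dspider_adj_irrefl.

End DoubleSpider.

Definition B_family p s (G : sgraph) : Prop :=
  exists p1 p2, [/\ 1 <= p1, 1 <= p2, p1 + p2 = p & iso G (B_ p1 p2 s)].

(* Add and AddStar are only meaningful for a base tree T without diametral
   k-twins; for any other T the families are empty. *)
Definition base k (T : sgraph) : Prop :=
  tree T /\ forall u : T, ~~ diametral_twin k u.

Definition extension (T : sgraph) r (G : sgraph) : Prop :=
  [/\ tree G, #|G| = #|T| + r, diam G = diam T & subgraph T G].

Definition Add k (T : sgraph) r (G : sgraph) : Prop :=
  [/\ base k T, extension T r G & forall u : G, ~~ diametral_twin k u].

Definition AddStar k (T : sgraph) r (G : sgraph) : Prop :=
  [/\ base k T, extension T r G & forall x y : G, ~~ special k x y].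

Definition Add_class k (C : sgraph -> Prop) r (G : sgraph) : Prop :=
  exists2 T, C T & Add k T r G.

(* Main.v *)
Require Import Defs.
From mathcomp Require Import all_boot zify.

Set Implicit Arguments.
Unset Strict Implicit.
Unset Printing Implicit Defensive.

(** Put [s = (k + 1) / 2] and call two vertices in conflict when they are at
    distance at most [k = 2 s - 1]. The [k]-MDISs are the maximal independent
    sets of the conflict graph; let [m] be their number, [n] the number of
    vertices and [p = (n - 1) %/ s].

    Lower bound: [n + 1 <= m + p] as soon as [n > s] ([mis_lower_bound]). If the
    diameter is below [2 s], everything is in conflict and [m = n]. Otherwise let
    [u] be an end of a diametral path, [w] the vertex of that path at distance [s]
    from [u], and [X] the part of the tree that hangs at [w] on the side of [u].
    It has at least [s] vertices, they are pairwise in conflict, and each of them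
    is in conflict with everything that [u] is in conflict with. Hence each
    maximal independent set of the rest survives, possibly completed by [u], and
    every other vertex of [X] lies in at least one further set ([mis_gain]). So
    deleting [X] destroys at least [#|X| - 1] sets, while [p] drops by at least
    one, and induction applies.

    Equality fails as soon as some vertex of [X] other than [u] lies in two maximal
    sets ([mis_lower_bound_strict]). This happens when the diameter is at least
    [2 s + 2], when it is [2 s + 1] and there is a diametral [k]-twin, and when it
    is [2 s] and there is a [k]-special pair ([far_strict], [twin_strict],
    [special_strict]).

    In the remaining trees the conflict graph has a large clique such that nearly
    every maximal independent set is determined by its vertex in the clique. This
    gives [n + 1 = m + q], where [q] is the number of branches reaching depth [s]
    below the central vertex or the central edge ([card_MDIS_even],
    [card_MDIS_odd]). Such branches contain the legs of an embedded spider or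
    double spider, so [q <= p], and equality holds in the lower bound iff [q = p],
    that is iff the tree contains [S_ p s], respectively some [B_ p1 p2 s] with
    [p1 + p2 = p]. Conversely embedded trees keep their distances
    ([hom_isometric]), so that containing one of these trees forces [q >= p].
    Finally a spider with surplus leaves at its centre attains the bound, so that
    the minimal trees are those with [n + 1 = m + p]. *)

(** * Maximal independent sets of a graph *)

Section MaximalIndependentSets.
Variables (T : finType) (e : rel T).
Hypotheses (e_refl : reflexive e) (e_sym : symmetric e).
Implicit Types (x y u v : T) (J W X : {set T}).

Definition indep J : bool :=
  [forall x in J, forall y in J, (x != y) ==> ~~ e x y].

Lemma indepP J :
  reflect (forall x y, x \in J -> y \in J -> e x y -> x = y) (indep J).
Proof.
apply: (iffP idP) => [/forall_inP iJ x y xJ yJ exy | iJ].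
  move/forall_inP: (iJ x xJ) => /(_ y yJ).
  by case: eqP => //= _; rewrite exy.
apply/forall_inP => x xJ; apply/forall_inP => y yJ.
by apply/implyP; apply: contraNN => exy; rewrite (iJ x y).
Qed.

(** The maximal independent sets of the subgraph induced by [W]; working inside
    one ambient graph lets vertices be deleted without changing the type. *)
Definition mis W : {set {set T}} :=
  [set J | maxset (fun J => indep J && (J \subset W)) J].

Definition mis_with W x : {set {set T}} := [set J in mis W | x \in J].

Lemma indepS J1 J2 : J1 \subset J2 -> indep J2 -> indep J1.
Proof.
by move=> /subsetP s12 /indepP i2; apply/indepP => x y /s12 ? /s12 ?; apply: i2.
Qed.

Lemma indep1 x : indep [set x].
Proof. by apply/indepP => y z /set1P-> /set1P->. Qed.

Lemma indep2 x y : ~~ e x y -> indep [set x; y].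
Proof.
move=> nexy; apply/indepP => a b /set2P[]-> /set2P[]-> //; first by rewrite (negPf nexy).
by rewrite e_sym (negPf nexy).
Qed.

Lemma indepU1 u J :
  indep J -> (forall y, y \in J -> ~~ e u y) -> indep (u |: J).
Proof.
move=> /indepP iJ far; apply/indepP => x y /setU1P[-> | xJ] /setU1P[-> | yJ] //.
- by rewrite (negPf (far y yJ)).
- by rewrite e_sym (negPf (far x xJ)).
- exact: iJ.
Qed.

(** For a reflexive conflict relation, maximality is domination: members
    of [J] are dominated by themselves. *)
Lemma misP W J :
  reflect [/\ indep J, J \subset W
            & forall x, x \in W -> exists2 y, y \in J & e x y] (J \in mis W).
Proof.
rewrite inE; apply: (iffP maxsetP) => [[/andP[iJ sJ] maxJ] | [iJ sJ dom]].
  split=> // x xW; apply/exists_inP; apply: contraT => /exists_inPn far.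
  have /maxJ E: indep (x |: J) && (x |: J \subset W).
    by rewrite indepU1 //= subUset sub1set xW.
  have xJ : x \in J by rewrite -E ?subsetUr // setU11.
  by have := far _ xJ; rewrite e_refl.
split=> [|K /andP[/indepP iK /subsetP sK] sJK]; first by rewrite iJ.
apply/eqP; rewrite eqEsubset sJK andbT; apply/subsetP => x xK.
have [y yJ exy] := dom x (sK x xK).
by rewrite (iK x y) // (subsetP sJK).
Qed.

Lemma mis_ext W J :
  indep J -> J \subset W -> exists2 K, K \in mis W & J \subset K.
Proof.
move=> iJ sJ; have [|K maxK sJK] := @maxset_exists _ (fun J => indep J && (J \subset W)) J.
  by rewrite iJ.
by exists K => //; rewrite inE.
Qed.

Lemma mis_with_gt0 W x : x \in W -> 0 < #|mis_with W x|.
Proof.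
move=> xW; have [|K misK] := mis_ext (indep1 x) (W := W); first by rewrite sub1set.
by rewrite sub1set => xK; apply/card_gt0P; exists K; rewrite inE misK.
Qed.

(** Two vertices in conflict with each other but not with [x] cannot both
    complete [x]: they force two different maximal sets through [x]. *)
Lemma mis_with_gt1 W x y1 y2 :
    x \in W -> y1 \in W -> y2 \in W -> y1 != y2 -> e y1 y2 ->
    ~~ e x y1 -> ~~ e x y2 -> 1 < #|mis_with W x|.
Proof.
move=> xW y1W y2W ny e12 f1 f2.
have ext y : y \in W -> ~~ e x y -> exists2 K, K \in mis_with W x & y \in K.
  move=> yW /indep2 i2; have [|K mK] := mis_ext i2 (W := W).
    by rewrite subUset !sub1set xW.
  by rewrite subUset !sub1set => /andP[xK yK]; exists K; rewrite // inE mK.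
have [[K1 K1m y1K] [K2 K2m y2K]] := (ext _ y1W f1, ext _ y2W f2).
apply/card_gt1P; exists K1, K2; split=> //; apply: contraNneq ny => E.
move: K1m; rewrite inE => /andP[/misP[/indepP iK _ _] _].
by rewrite (iK y1 y2) // E.
Qed.

Definition clique X : Prop := {in X &, forall x y, e x y}.

Lemma clique_le1 X J : clique X -> indep J -> #|J :&: X| <= 1.
Proof.
move=> cX /indepP iJ; apply/card_le1P => x /setIP[xJ xX] y.
rewrite !inE; apply/andP/eqP => [[yJ yX] | ->]; last by [].
by apply: iJ => //; apply: cX.
Qed.

(** A maximal independent set meets a clique at most once, so that counting the
    sets meeting the clique amounts to counting those through each vertex. *)
Lemma card_mis_meet W X : clique X ->
  #|[set J in mis W | J :&: X != set0]| = \sum_(x in X) #|mis_with W x|.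
Proof.
move=> cX.
transitivity (\sum_(J in mis W) #|J :&: X|).
  rewrite -sum1_card (eq_bigl (fun J => (J \in mis W) && (J :&: X != set0))); last first.
    by move=> J; rewrite inE.
  rewrite big_mkcondr; apply: eq_bigr => J /misP[iJ _ _].
  have := clique_le1 cX iJ; rewrite -card_gt0; by case: #|_| => [|[]].
have cardI J : #|J :&: X| = \sum_(x in X) (x \in J).
  rewrite -sum1_card (eq_bigl (fun x => (x \in X) && (x \in J))) ?big_mkcondr.
    by apply: eq_bigr => x _; case: (x \in J).
  by move=> x; rewrite inE andbC.
rewrite (eq_bigr _ (fun J _ => cardI J)) exchange_big; apply: eq_bigr => x _.
rewrite -sum1_card [RHS](eq_bigl (fun J => (J \in mis W) && (x \in J))); last first.
  by move=> J; rewrite !inE.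
by rewrite [RHS]big_mkcondr; apply: eq_bigr => J _; case: (x \in J).
Qed.

(** Deleting a clique [X] all of whose vertices are at least as conflicting as
    [u \in X]: a maximal independent set of the rest either already dominates
    [X], or is completed by [u]; the sets through [X :\ u] come on top. *)
Lemma mis_gain W X u :
    clique X -> X \subset W -> u \in X ->
    (forall x y, x \in X -> y \in W -> e u y -> e x y) ->
  #|mis (W :\: X)| + \sum_(x in X :\ u) #|mis_with W x| <= #|mis W|.
Proof.
move=> cX /subsetP sXW uX dom.
have cXu : clique (X :\ u) by move=> x y /setD1P[_ ?] /setD1P[_ ?]; apply: cX.
rewrite -card_mis_meet //; set M := [set J in _ | _].
have sM : M \subset mis W by apply/subsetP => J; rewrite inE => /andP[].
rewrite -(cardsID M (mis W)) (setIidPr sM) addnC leq_add2l.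
(* It remains to map [mis (W :\: X)] injectively into the sets that miss
   [X :\ u]; removing [X] is the inverse of [h]. *)
pose h J := if [exists y in J, e u y] then J else u |: J.
have off J : J \in mis (W :\: X) -> J :&: X = set0.
  by case/misP=> _ sJ _; apply/setP => x; rewrite !inE; apply/negP => /andP[/(subsetP sJ)];
     rewrite !inE => /andP[/negPf->].
have hX J : J \in mis (W :\: X) -> h J :\: X = J.
  move=> mJ; have dJ : J :\: X = J.
    by apply/setDidPl; rewrite disjoints_subset; apply/subsetP => x xJ; rewrite inE;
       apply/negP => xX; have := off J mJ; move/setP/(_ x); rewrite !inE xJ xX.
  by rewrite /h; case: ifP => // _; rewrite setDUl dJ setDE; apply/setP => x; rewrite !inE;
     case: eqP => // ->; rewrite uX.
have h_inj : {in mis (W :\: X) &, injective h}.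
  by move=> J K mJ mK E; rewrite -(hX J mJ) -(hX K mK) E.
rewrite -(card_in_imset h_inj); apply: subset_leq_card; apply/subsetP => _ /imsetP[J mJ ->].
have oJ := off J mJ; case/misP: (mJ) => iJ sJ domJ.
have sJW : J \subset W by apply: subset_trans sJ (subsetDl _ _).
have hmis : h J \in mis W.
  apply/misP; rewrite /h; case: ifPn => [/exists_inP[y yJ euy] | /exists_inPn far].
    split=> // x xW; have [xX | xX] := boolP (x \in X); last by apply: domJ; rewrite inE xX.
    by exists y => //; apply: dom; rewrite ?(subsetP sJW).
  split=> [||x xW]; first exact: indepU1.
  - by rewrite subUset sub1set sXW.
  - have [xX | xX] := boolP (x \in X); first by exists u; rewrite ?setU11 //; apply: cX.
    have [|y yJ exy] := domJ x; first by rewrite inE xX.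
    by exists y; rewrite // inE yJ orbT.
rewrite inE hmis andbT inE hmis /= negbK; apply/eqP/setP => x; rewrite !inE.
apply/negP => /andP[xh /andP[xu xX]].
have xJ : x \in J by move: xh; rewrite /h; case: ifP => // _ /setU1P[E|//]; rewrite E eqxx in xu.
by move/setP: oJ => /(_ x); rewrite !inE xJ xX.
Qed.

(** If the vertices not in conflict with [x] are independent, they form with
    [x] the only maximal independent set through [x]. *)
Lemma card_mis_with1 W x :
    x \in W -> indep [set y in W | ~~ e x y] -> #|mis_with W x| = 1.
Proof.
move=> xW iF; apply/eqP; rewrite eqn_leq mis_with_gt0 // andbT.
have E J : J \in mis_with W x -> J = x |: [set y in W | ~~ e x y].
  rewrite inE => /andP[/misP[/indepP iJ /subsetP sJ domJ] xJ]; apply/setP => y.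
  rewrite !inE; apply/idP/orP => [yJ | [/eqP-> // | /andP[yW nxy]]].
    case: eqP => [|nyx]; [by left | right; rewrite sJ //=].
    by apply/negP => exy; case: nyx; rewrite (iJ x y).
  have [z zJ eyz] := domJ y yW; have [zx | nxz] := eqVneq z x.
    by rewrite zx e_sym (negPf nxy) in eyz.
  have nxz' : ~~ e x z by apply: contraNN nxz => exz; rewrite (iJ x z).
  by rewrite (indepP _ iF y z) // inE ?yW ?(sJ z).
by apply/card_le1P => J mJ K; rewrite [RHS]inE; apply/idP/eqP => [mK | -> //]; rewrite (E K mK) (E J mJ).
Qed.

Lemma card_mis_meet1 W X :
    clique X -> X \subset W ->
    (forall x, x \in X -> indep [set y in W | ~~ e x y]) ->
  #|[set J in mis W | J :&: X != set0]| = #|X|.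
Proof.
move=> cX /subsetP sX iX; rewrite card_mis_meet // -sum1_card.
by apply: eq_bigr => x xX; apply: card_mis_with1; [apply: sX | apply: iX].
Qed.

End MaximalIndependentSets.

(** * Distance in connected graphs *)

Section ConnectedDistance.
Variable G : sgraph.
Hypothesis connG : connected G.
Implicit Types (x y z : G).
Notation d := (@dist G).

Lemma walkP m x y :
  reflect (exists w, [/\ size w = m, path (@adj G) x w & last x w = y]) (walk m x y).
Proof.
apply: (iffP existsP) => [[w /andP[pw /eqP lw]] | [w [sw pw lw]]].
  by exists w; rewrite size_tuple.
by move/eqP: sw => sw; exists (Tuple sw); rewrite /= pw lw /=.
Qed.

Lemma dist_ltcard x y : d x y < #|G|.
Proof.
rewrite /dist -[X in _ < X](size_iota 0 #|G|) -has_find.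
have /connectP[w0 pw0 ->] := connG.2 x y; case/shortenP: pw0 => w pw uw _.
apply/hasP; exists (size w); last by apply/walkP; exists w.
by rewrite mem_iota add0n -[(size w).+1]/(size (x :: w)) -(card_uniqP uw) max_card.
Qed.

Lemma walk_dist x y : walk (d x y) x y.
Proof.
have lt := dist_ltcard x y; have := lt.
rewrite {1}/dist -[X in _ < X](size_iota 0 #|G|) -has_find => /(nth_find 0).
by rewrite nth_iota.
Qed.

Lemma dist_le_walk m x y : walk m x y -> d x y <= m.
Proof.
move=> wm; rewrite leqNgt; apply/negP => lt_m.
have le_d : d x y <= #|G| by rewrite -[X in _ <= X](size_iota 0); apply: find_size.
have := before_find 0 lt_m; rewrite nth_iota ?add0n ?wm //.
exact: leq_trans lt_m le_d.
Qed.

Lemma dist_xx x : d x x = 0.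
Proof. by apply/eqP; rewrite -leqn0; apply: dist_le_walk; apply/walkP; exists [::]. Qed.

Lemma dist_eq0 x y : d x y = 0 -> x = y.
Proof. by move=> d0; have := walk_dist x y; rewrite d0 => /walkP[[|a w] []]. Qed.

Lemma dist_tri z x y : d x y <= d x z + d z y.
Proof.
have /walkP[w1 [s1 p1 l1]] := walk_dist x z.
have /walkP[w2 [s2 p2 l2]] := walk_dist z y.
apply: dist_le_walk; apply/walkP; exists (w1 ++ w2).
by rewrite size_cat s1 s2 cat_path last_cat p1 l1 p2 l2.
Qed.

Lemma dist_sym x y : d x y = d y x.
Proof.
suff le a b : d a b <= d b a by apply/eqP; rewrite eqn_leq !le.
have /walkP[w [sw pw lw]] := walk_dist b a; apply: dist_le_walk; apply/walkP.
exists (rev (belast b w)); rewrite size_rev size_belast sw; split=> //.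
  by rewrite -lw rev_path; apply: sub_path pw => u v; rewrite adj_sym.
by case: w {sw pw} lw => [|c w] //= _; rewrite rev_cons last_rcons.
Qed.

Lemma adj_dist x y : adj x y = (d x y == 1).
Proof.
apply/idP/eqP => [axy | d1].
  have : d x y <= 1 by apply: dist_le_walk; apply/walkP; exists [:: y]; rewrite /= axy.
  have : d x y <> 0 by move/dist_eq0=> E; rewrite E adj_irrefl in axy.
  by case: (d x y) => [|[]].
by have := walk_dist x y; rewrite d1 => /walkP[[|a [|b w]] [] // _ /= /andP[ax _] <-].
Qed.

Lemma dist_adj x y : adj x y -> d x y = 1.
Proof. by rewrite adj_dist => /eqP. Qed.

Lemma dist_step x y : 0 < d x y -> exists2 z, adj x z & d x y = (d z y).+1.
Proof.
move=> d_gt0; have /walkP[[|z w] [/= sw]] := walk_dist x y; first by lia.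
case/andP=> axz pw lw; exists z => //.
have : d z y <= size w by apply: dist_le_walk; apply/walkP; exists w.
by have := dist_tri z x y; rewrite (dist_adj axz); lia.
Qed.

Lemma dist_point x y i : i <= d x y ->
  exists z, d x z = i /\ d x z + d z y = d x y.
Proof.
move: {2}(d x y - i) (leqnn (d x y - i)) => m; elim: m i => [|m IHm] i le_m le_i.
  by exists y; rewrite dist_xx; lia.
have [E | ne] := eqVneq i (d x y); first by exists y; rewrite dist_xx; lia.
have [||z [dxz E]] := IHm i.+1; [lia | lia |].
have [|t atz dt] := @dist_step z x; first by rewrite dist_sym; lia.
exists t; rewrite (dist_sym x t).
have := dist_tri t x y; have := dist_tri z t y.
rewrite (dist_sym z x) in dt; rewrite (dist_sym x t) [d t z]dist_sym (dist_adj atz); lia.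
Qed.

Definition interval x y : {set G} := [set z | d x z + d z y == d x y].

Lemma card_interval x y : d x y < #|interval x y|.
Proof.
pose f z : 'I_(d x y).+1 := inord (d x z).
rewrite -{1}[(d x y).+1]card_ord; apply: leq_trans (leq_imset_card f _).
apply/subset_leq_card/subsetP => i _.
have [|z [dz E]] := @dist_point x y i; first by rewrite -ltnS.
by apply/imsetP; exists z; rewrite ?inE ?E // /f dz inord_val.
Qed.

Definition convex (W : {set G}) : Prop :=
  forall x y, x \in W -> y \in W -> interval x y \subset W.

Lemma dist_le_diam x y : d x y <= diam G.
Proof.
apply: leq_trans (leq_bigmax x); exact: (leq_bigmax y).
Qed.

Lemma diam_witness : exists x y, d x y = diam G.
Proof.
have gt0 := connG.1; have [x Ex] := eq_bigmax (@ecc G) gt0.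
by have [y Ey] := eq_bigmax (@dist G x) gt0; exists x, y; rewrite /diam Ex /ecc Ey.
Qed.

Lemma ecc_diamP x : reflect (exists y, d x y = diam G) (ecc x == diam G).
Proof.
have ed : ecc x <= diam G by apply: (leq_bigmax x).
apply: (iffP eqP) => [<- | [y dy]].
  by have [y E] := eq_bigmax (@dist G x) connG.1; exists y; rewrite -E.
by apply/eqP; rewrite eqn_leq ed -dy (leq_bigmax y).
Qed.

Lemma dist_lipschitz (g : G -> nat) x y :
  (forall a b, adj a b -> g b <= (g a).+1) -> g y <= g x + d x y.
Proof.
move=> lip; move: {2}(d x y) (erefl (d x y)) => m; elim: m x => [|m IHm] x dm.
  by rewrite (dist_eq0 dm) dist_xx addn0.
have [|z axz dz] := @dist_step x y; first by rewrite dm.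
have := lip _ _ axz; have := IHm z; lia.
Qed.

End ConnectedDistance.

(** * Distance in trees *)

Section TreeDistance.
Variable G : sgraph.
Hypothesis treeG : tree G.
Implicit Types (x y z a b : G).
Notation d := (@dist G).
Let connG := treeG.1.

Definition del_edge a b : rel G := fun x y =>
  adj x y && ~~ ((x == a) && (y == b) || (x == b) && (y == a)).

Lemma del_edge_sym a b : symmetric (del_edge a b).
Proof.
move=> x y; rewrite /del_edge adj_sym; congr (_ && ~~ _).
by rewrite orbC [(y == a) && _]andbC [(y == b) && _]andbC.
Qed.

Lemma del_edge_separates a b : adj a b -> ~~ connect (del_edge a b) a b.
Proof.
move=> ab; apply/negP => /connectP[w0 pw0]; case/shortenP: pw0 => w pw uw _ lw.
have pw' : path (@adj G) a w by apply: sub_path pw => x y /andP[].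
have : ucycle (@adj G) (a :: w).
  by rewrite /ucycle uw andbT /= rcons_path pw' -lw /= adj_sym.
move/treeG.2; case: w pw lw {uw pw'} => [_ /= E | c [|//] /=]; last first.
  by rewrite andbT => + E; rewrite -E /del_edge !eqxx andbF.
by rewrite E adj_irrefl in ab.
Qed.

(** A geodesic from [x] to the nearer end of an edge avoids that edge. *)
Lemma closer_connect a b x :
  adj a b -> d x a <= d x b -> connect (del_edge a b) x a.
Proof.
move=> ab; move: {2}(d x a) (erefl (d x a)) => m; elim: m x => [|m IHm] x dm.
  by rewrite (dist_eq0 connG dm).
have [|z axz dz] := @dist_step _ connG x a; first by rewrite dm.
move=> le_ab; have := dist_tri connG z x b; rewrite (dist_adj connG axz) => tri.
apply: connect_trans (IHm z _ _); [|lia|lia].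
apply: connect1; rewrite /del_edge axz /=; apply/negP.
case/orP=> /andP[/eqP E _]; rewrite E in dm le_ab.
  by rewrite dist_xx in dm.
by rewrite dist_xx in le_ab; lia.
Qed.

(** Trees are bipartite: equal distances from [x] to both ends of an edge would
    connect the ends without that edge. *)
Lemma sideP a b x : adj a b -> d x b = (d x a).+1 \/ d x a = (d x b).+1.
Proof.
move=> ab; have ba : adj b a by rewrite adj_sym.
have := dist_tri connG a x b; have := dist_tri connG b x a.
rewrite (dist_adj connG ab) (dist_adj connG ba).
case: (eqVneq (d x a) (d x b)) => [E | ]; last by lia.
case/negP: (del_edge_separates ab); apply: (@connect_trans _ _ x).
  by rewrite (sym_connect_sym (@del_edge_sym a b)) closer_connect // E.
rewrite (eq_connect (_ : _ =2 del_edge b a)) ?closer_connect // ?E //.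
by move=> u v; rewrite /del_edge orbC.
Qed.

Lemma side_lt a b x : adj a b -> d x a < d x b \/ d x b < d x a.
Proof. by move=> /(sideP x)[] ->; [left | right]. Qed.

(** A geodesic from the [a]-side to the [b]-side of the edge [ab] must use that
    edge, since deleting it separates the two sides. *)
Lemma dist_cut a b x y : adj a b -> d x a < d x b -> d y b < d y a ->
  d x y = d x a + 1 + d b y.
Proof.
move=> ab xa yb; apply/eqP; rewrite eqn_leq; apply/andP; split.
  have := dist_tri connG a x y; have := dist_tri connG b a y.
  by rewrite (dist_adj connG ab); lia.
move: {2}(d x y) (erefl (d x y)) => m; elim: m x xa => [|m IHm] x xa dm.
  by rewrite -(dist_eq0 connG dm) in yb; lia.
have [|z axz dz] := @dist_step _ connG x y; first by rewrite dm.
have tri := dist_tri connG z x a; rewrite (dist_adj connG axz) in tri.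
have [za | zb] := ltnP (d z a) (d z b); first by have := IHm z za; lia.
have sep := del_edge_separates ab.
have : ~~ del_edge a b x z.
  apply: contraNN sep => xz; apply: (@connect_trans _ _ x).
    by rewrite (sym_connect_sym (@del_edge_sym a b)) closer_connect // ltnW.
  apply: (connect_trans (connect1 xz)).
  rewrite (eq_connect (_ : _ =2 del_edge b a)) ?closer_connect //.
    by rewrite adj_sym.
  by move=> u v; rewrite /del_edge orbC.
rewrite /del_edge axz negbK => /orP[] /andP[/eqP Ex /eqP Ez]; subst x z.
  by rewrite dist_xx // dz; lia.
by rewrite (dist_xx) in xa.
Qed.

(** Among two neighbours of [y], the second lies beyond [y] as seen from the
    first, so that only one of them can be closer to [x] than [y] is. *)
Lemma closer_uniq x y a b :
  adj y a -> adj y b -> d x a < d x y -> d x b < d x y -> a = b.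
Proof.
move=> ya yb xa xb; apply/eqP; apply: contraT => nab.
have ay : adj a y by rewrite adj_sym.
have by1 := dist_adj connG yb; have ba0 : d b a <> 0.
  by move/(dist_eq0 connG)=> E; rewrite E eqxx in nab.
rewrite (dist_sym connG) in by1.
have ba : d b y < d b a by have := sideP b ya; lia.
have := dist_cut ay xa ba; rewrite (dist_sym connG y b) by1.
by have := sideP x yb; have := sideP x ya; lia.
Qed.

(** Half-trees are convex: a geodesic leaving one side of an edge would have to
    cross that edge twice. *)
Lemma convex_side a b (W : {set G}) : adj a b -> convex W ->
  convex [set x in W | d x a < d x b].
Proof.
move=> ab cW x y; rewrite !inE => /andP[xW xa] /andP[yW ya].
apply/subsetP => z zI; rewrite inE (subsetP (cW x y xW yW)) //=.
move: zI; rewrite inE => /eqP dz; rewrite ltnNge; apply/negP => zb.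
have {}zb : d z b < d z a by have := sideP z ab; lia.
have := dist_cut ab xa zb; have := dist_cut ab ya zb.
have := dist_tri connG a x y; rewrite (dist_sym connG y z) (dist_sym connG y a); lia.
Qed.

End TreeDistance.

Definition hom (G H : sgraph) (f : G -> H) : Prop :=
  forall x y, adj x y -> adj (f x) (f y).

(** By induction on the distance: if [y''], [y'], [y] end a geodesic from [x],
    then [f y''] is the only neighbour of [f y'] that is closer to [f x], and
    [f y] is another one. *)
Lemma hom_isometric (G H : sgraph) (f : G -> H) :
  tree G -> tree H -> injective f -> hom f ->
  forall x y, dist (f x) (f y) = dist x y.
Proof.
move=> [cG _] tH f_inj fh x y; have cH := tH.1.
suff : forall m y, dist x y = m -> dist (f x) (f y) = m by move=> /(_ _ y erefl).
move=> m; elim/ltn_ind: m => -[|m] IHm {}y dm.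
  by rewrite (dist_eq0 cG dm) dist_xx.
have [|y' ay' dy'] := @dist_step _ cG y x; first by rewrite dist_sym ?dm.
rewrite (dist_sym cG y) (dist_sym cG y') dm in dy'.
have Fy' : dist (f x) (f y') = m by apply: IHm; lia.
have ad : adj (f y') (f y) by apply: fh; rewrite adj_sym.
case: m => [|m] in IHm dm dy' Fy' *.
  by rewrite (dist_eq0 cG (y := y') (x := x)) ?(dist_adj cH) //; lia.
have [|y'' ay'' dy''] := @dist_step _ cG y' x; first by rewrite (dist_sym cG); lia.
rewrite (dist_sym cG y') (dist_sym cG y'') in dy''.
have Fy'' : dist (f x) (f y'') = m by apply: IHm; lia.
have [|] := sideP tH (f x) ad; first by lia.
move=> lt; have : f y'' = f y by apply: (closer_uniq tH (fh _ _ ay'') ad (x := f x)); lia.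
move/f_inj => E; rewrite E in dy''; lia.
Qed.

(** * Cutting off the end of a diametral path *)

(** The conflict relation: the distance-[k] independent sets are its independent
    sets, so that results on maximal independent sets apply to [MDIS G k]. *)
Definition close k (G : sgraph) : rel G := fun x y => dist x y <= k.
Arguments close k {G} x y.

Lemma close_refl k (G : sgraph) : reflexive (@close k G).
Proof. by move=> x; rewrite /close dist_xx. Qed.

Lemma close_sym k (G : sgraph) : connected G -> symmetric (@close k G).
Proof. by move=> cG x y; rewrite /close (dist_sym cG). Qed.

Lemma MDIS_mis (G : sgraph) k : MDIS G k = mis (@close k G) [set: G].
Proof.
apply/setP => J; rewrite !inE; apply: maxset_eq => {}J.
rewrite subsetT andbT /dist_indep /indep.
by under eq_forallb => x do under eq_forallb => y do rewrite ltnNge.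
Qed.

Section Pendant.
Variables (G : sgraph) (s : nat).
Hypothesis treeG : tree G.
Let connG := treeG.1.
Notation d := (@dist G).
Implicit Types (x y z u v w b : G) (W : {set G}).

(** The edge [wb] of a [u]-[v] geodesic whose ends are at distance [s] and
    [s - 1] from [u]; the equations avoid truncated subtraction. *)
Definition cut_at u v w b : Prop :=
  [/\ adj w b, d u w = s, (d u b).+1 = s, d w v + s = d u v
    & d b v + s = (d u v).+1].

Lemma cut_exists u v : 0 < s <= d u v -> exists w b, cut_at u v w b.
Proof.
case/andP=> s_gt0 big; have [w [duw E]] := dist_point connG big.
have [|b wb db] := @dist_step _ connG w u; first by rewrite dist_sym // duw; lia.
rewrite (dist_sym connG w) (dist_sym connG b) in db.
exists w, b; split=> //; try lia.
have := dist_tri connG b u v; have := sideP treeG v wb.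
by rewrite !(dist_sym connG v); lia.
Qed.

Definition pendant W w b : {set G} := [set x in W | d x b < d x w].

Lemma pendant_sub W w b : pendant W w b \subset W.
Proof. by apply/subsetP => x; rewrite inE => /andP[]. Qed.

Lemma pendant_compl W w b : adj w b ->
  W :\: pendant W w b = [set x in W | d x w < d x b].
Proof.
move=> wb; apply/setP => x; rewrite !inE; case: (x \in W); rewrite //= ?andbT ?andbF //.
by have := side_lt treeG x wb; lia.
Qed.

Variables (u v w b : G).
Hypothesis cut : cut_at u v w b.

Let wb : adj w b. Proof. by case: cut. Qed.
Let bw : adj b w. Proof. by rewrite adj_sym. Qed.

Lemma cut_end_below : d u b < d u w.
Proof. by case: cut; lia. Qed.

Lemma dist_across x y : d x b < d x w -> d y w < d y b -> d x y = d x w + d w y.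
Proof.
by move=> xb yw; rewrite (dist_cut treeG bw xb yw); have := sideP treeG x wb; lia.
Qed.

Variable W : {set G}.
Let X := pendant W w b.

Lemma mem_pendant : u \in W -> u \in X.
Proof. by rewrite inE cut_end_below => ->. Qed.

Lemma nmem_pendant : v \in W -> v \in W :\: X.
Proof.
by rewrite pendant_compl // inE => ->; rewrite !(dist_sym connG v); case: cut; lia.
Qed.

Lemma dist_pendant x : x \in X -> d x w = (d x b).+1.
Proof. by rewrite inE => /andP[_]; have := sideP treeG x wb; lia. Qed.

Lemma dist_pendant_compl x y : x \in X -> y \in W :\: X -> d x y = d x w + d w y.
Proof.
by rewrite pendant_compl // !inE => /andP[_ xb] /andP[_ yw]; apply: dist_across.
Qed.

Hypotheses (convW : convex W) (uW : u \in W) (vW : v \in W).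

Lemma pendant_convex : convex (W :\: X).
Proof. by rewrite pendant_compl //; apply: convex_side. Qed.

Lemma card_pendant : s <= #|X|.
Proof.
case: cut => _ duw dub dwv dbv; rewrite -dub; apply: leq_trans (card_interval connG _ _) _.
have sub : interval u w \subset W.
  apply: subset_trans (convW uW vW); apply/subsetP => z; rewrite !inE => /eqP dz.
  have := dist_tri connG w z v; have := dist_tri connG z u v; lia.
apply/subset_leq_card/subsetP => z; rewrite inE => /eqP dz.
have tri := dist_tri connG z u w; have := sideP treeG z wb => side.
rewrite inE; apply/andP; split; last by lia.
apply: (subsetP sub); rewrite inE; have := dist_tri connG b z w; rewrite (dist_adj connG bw).
by lia.
Qed.

Lemma card_pendant_compl : d w v < #|W :\: X|.
Proof.
case: cut => _ duw dub dwv dbv; apply: leq_trans (card_interval connG _ _) _.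
apply/subset_leq_card/subsetP => z; rewrite inE => /eqP dz.
rewrite pendant_compl // inE; apply/andP; split.
  apply: (subsetP (convW uW vW)); rewrite inE.
  have := dist_tri connG w u z; have := dist_tri connG z u v; lia.
have := dist_tri connG z b v; rewrite (dist_sym connG b z) (dist_sym connG z w); lia.
Qed.

Hypothesis maxW : {in W &, forall x y, d x y <= d u v}.

(** A vertex of [X] deeper than [u] would be farther from [v] than [u] is. *)
Lemma pendant_depth x : x \in X -> d x w <= s.
Proof.
move=> xX; have xW := subsetP (pendant_sub W w b) x xX.
have := maxW xW vW; rewrite (dist_pendant_compl xX (nmem_pendant vW)).
by case: cut; lia.
Qed.

Variable k : nat.
Hypothesis kE : k.+1 = 2 * s.

Lemma pendant_clique : clique (close k) X.
Proof.
move=> x y xX yX; rewrite /close; have := dist_tri connG b x y.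
have := pendant_depth xX; have := pendant_depth yX.
by rewrite !dist_pendant // (dist_sym connG b); lia.
Qed.

(** Outside [X] distances pass through [w], and [u] is at maximal depth. *)
Lemma pendant_dominated x y :
  x \in X -> y \in W -> close k u y -> close k x y.
Proof.
move=> xX yW; have [yX _ | yX] := boolP (y \in X); first exact: pendant_clique.
have yD : y \in W :\: X by rewrite inE yX.
rewrite /close (dist_pendant_compl (mem_pendant uW) yD) (dist_pendant_compl xX yD).
by have := pendant_depth xX; case: cut; lia.
Qed.

Lemma pendant_gain :
  #|mis (close k) (W :\: X)| + \sum_(x in X :\ u) #|mis_with (close k) W x|
    <= #|mis (close k) W|.
Proof.
apply: mis_gain; [exact: close_refl | exact: close_sym | exact: pendant_clique
  | exact: pendant_sub | exact: mem_pendant | exact: pendant_dominated].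
Qed.

End Pendant.

(** * The lower bound *)

Section LowerBound.
Variables (G : sgraph) (s k : nat).
Hypotheses (treeG : tree G) (s_gt0 : 0 < s) (kE : k.+1 = 2 * s).
Let connG := treeG.1.
Notation d := (@dist G).
Notation M := (mis (@close k G)).
Implicit Types (x y z u v w b : G) (W : {set G}).

Lemma card_mis_clique W : clique (close k) W -> #|W| <= #|M W|.
Proof.
move=> cW; pose P := [set J in M W | J :&: W != set0].
apply: (@leq_trans #|P|); last by apply: subset_leq_card; apply/subsetP => J; rewrite inE => /andP[].
rewrite /P card_mis_meet; [|exact: close_refl | exact: close_sym | by []].
rewrite -sum1_card; apply: leq_sum => x xW.
exact: mis_with_gt0.
Qed.

Lemma max_dist_pair W : 0 < #|W| ->
  exists u v, [/\ u \in W, v \in W & {in W &, forall x y, d x y <= d u v}].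
Proof.
case/card_gt0P => x0 x0W; pose P (p : G * G) := (p.1 \in W) && (p.2 \in W).
have P0 : P (x0, x0) by rewrite /P /= x0W.
case: (@arg_maxnP _ (x0, x0) P (fun p => d p.1 p.2) P0) => -[u v] /andP[/= uW vW] max.
by exists u, v; split=> // x y xW yW; apply: (max (x, y)); rewrite /P /= xW.
Qed.

(** Putting back [X] adds at least [s] vertices, hence at least one to the
    quotient, and by [pendant_gain] at least [c] maximal independent sets. *)
Lemma pendant_step W u v w b c :
    convex W -> u \in W -> v \in W -> {in W &, forall x y, d x y <= d u v} ->
    2 * s <= d u v -> cut_at s u v w b ->
    let X := pendant W w b in
    #|W :\: X| < #|M (W :\: X)| + #|W :\: X|.-1 %/ s ->
    c <= \sum_(x in X :\ u) #|mis_with (close k) W x| ->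
  #|W| + c < #|M W| + #|W|.-1 %/ s + #|X :\ u|.
Proof.
move=> convW uW vW maxW big cut X IH low.
have := pendant_gain treeG cut uW vW maxW kE; rewrite -/X => gain.
have Xs : s <= #|X| := card_pendant treeG cut convW uW vW.
have Ws := card_pendant_compl treeG cut convW uW vW; rewrite -/X in Ws.
have cWX := cardsID X W; rewrite (setIidPr _) ?pendant_sub // in cWX.
have cX := cardsD1 u X; rewrite (mem_pendant cut uW) in cX.
have : (1 * s + #|W :\: X|.-1) %/ s <= #|W|.-1 %/ s by apply: leq_div2r; lia.
by rewrite divnMDl; lia.
Qed.

Lemma pendant_low W u w b :
  #|pendant W w b :\ u| <= \sum_(x in pendant W w b :\ u) #|mis_with (close k) W x|.
Proof.
rewrite -sum1_card; apply: leq_sum => x /setD1P[_ xX].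
by apply/mis_with_gt0/(subsetP (pendant_sub W w b)).
Qed.

(** Stated for convex sets of vertices of a fixed tree, which are its subtrees.
    Below diameter [2 * s] all vertices are in conflict and each of them is a
    maximal set by itself. *)
Lemma mis_lower_bound W : convex W -> s < #|W| ->
  #|W| < #|M W| + #|W|.-1 %/ s.
Proof.
move: {2}#|W| (leqnn #|W|) => n; elim: n W => [|n IHn] W leW convW gtW; first by lia.
have [|u [v [uW vW maxW]]] := @max_dist_pair W; first by lia.
have [big | small] := leqP (2 * s) (d u v); last first.
  have : #|W| <= #|M W|.
    by apply: card_mis_clique => x y xW yW; have := maxW x y xW yW; rewrite /close; lia.
  have : 0 < #|W|.-1 %/ s by rewrite divn_gt0; lia.
  by lia.
have [|w [b cut]] := @cut_exists _ s treeG u v; first by lia.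
have Xs := card_pendant treeG cut convW uW vW.
have Ws := card_pendant_compl treeG cut convW uW vW.
have cWX := cardsID (pendant W w b) W; rewrite (setIidPr _) ?pendant_sub // in cWX.
have [_ _ _ dwv _] := cut.
have IH : #|W :\: pendant W w b| < #|M (W :\: pendant W w b)| + #|W :\: pendant W w b|.-1 %/ s.
  by apply: IHn => //; [lia | exact: (pendant_convex treeG cut convW) | lia].
have := pendant_step convW uW vW maxW big cut IH (pendant_low W u w b); lia.
Qed.

Lemma convexT : convex [set: G].
Proof. by move=> x y _ _; apply: subsetT. Qed.

(** The bound improves as soon as some vertex [x] other than [u] of the part cut
    off together with [u] lies in two maximal sets, here one through [y1] and one
    through [y2]. *)
Lemma mis_lower_bound_strict u v w b x y1 y2 :
    d u v = diam G -> 2 * s <= d u v -> cut_at s u v w b ->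
    x != u -> d x b < d x w ->
    y1 != y2 -> close k y1 y2 -> ~~ close k x y1 -> ~~ close k x y2 ->
  #|G|.+1 < #|MDIS G k| + #|G|.-1 %/ s.
Proof.
move=> duv big cut xu xb ny cy f1 f2; rewrite MDIS_mis -cardsT.
have max : {in [set: G] &, forall x y, d x y <= d u v}.
  by move=> ? ? _ _; rewrite duv dist_le_diam.
have [convT uT vT] : [/\ convex [set: G], u \in [set: G] & v \in [set: G]].
  by split; rewrite ?inE //; apply: convexT.
have xX : x \in pendant [set: G] w b :\ u by rewrite !inE xu.
have Ws := card_pendant_compl treeG cut convT uT vT.
have [_ _ _ dwv _] := cut.
have IH := mis_lower_bound (pendant_convex treeG cut convT) (_ : s < _).
have low : #|pendant [set: G] w b :\ u|.+1
    <= \sum_(x in pendant [set: G] w b :\ u) #|mis_with (close k) [set: G] x|.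
  rewrite (bigD1 x) //= (cardsD1 x) xX add1n -addn2 addnC; apply: leq_add.
    by apply: (@mis_with_gt1 _ (close k) _ _ _ _ y1 y2); rewrite ?inE //;
      [exact: close_refl | exact: close_sym].
  rewrite -sum1_card (eq_bigl _ _ (fun z => in_setD1 z _ _)) big_andbC.
  apply: leq_sum => z _.
  by apply: mis_with_gt0; rewrite inE.
have := pendant_step convT uT vT max big cut (IH _) low; lia.
Qed.

End LowerBound.

(** * Peripheral vertices and twins *)

Section Peripheral.
Variables (G : sgraph) (s k : nat).
Hypothesis treeG : tree G.
Let connG := treeG.1.
Notation d := (@dist G).
Implicit Types (x y z u v w b : G) (J : {set G}).

Definition peripheral x : bool := ecc x == diam G.

(** A second neighbour of [u] would be farther from [v] than the diameter. *)
Lemma leaf_end u v : 0 < diam G -> d u v = diam G -> leaf u.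
Proof.
move=> D_gt0 duv; have [|a ua da] := @dist_step _ connG u v; first by lia.
apply/cards1P; exists a; apply/setP => z; rewrite !inE; apply/idP/eqP => [uz | -> //].
have zu : d v z < d v u.
  have := sideP treeG v uz; have := dist_le_diam v z; rewrite (dist_sym connG v u); lia.
by apply: (closer_uniq treeG uz ua zu); rewrite !(dist_sym connG v); lia.
Qed.

Lemma diametral_leafE u : 0 < diam G -> diametral_leaf u = peripheral u.
Proof.
move=> D_gt0; have ed x : ecc x <= diam G by apply: (leq_bigmax x).
apply/andP/idP => [[_ /forallP max] | pu].
  have [x [y dxy]] := diam_witness connG; have lx := leaf_end D_gt0 dxy.
  have px : peripheral x by apply/(ecc_diamP connG); exists y.
  have := max x; rewrite lx (eqP px) /= => le.
  by rewrite /peripheral eqn_leq ed.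
have [v duv] := ecc_diamP connG _ pu; split; first exact: leaf_end D_gt0 duv.
by apply/forallP => x; apply/implyP => _; rewrite (eqP pu).
Qed.

Lemma mem_nbh x y : (y \in nbh k x) = close k x y.
Proof. by rewrite inE. Qed.

Lemma nbh_close x y : nbh k x = nbh k y -> close k x y.
Proof. by move=> E; rewrite -mem_nbh E mem_nbh close_refl. Qed.

Section Cut.
Variables u v w b : G.
Hypotheses (duv : d u v = diam G) (cut : cut_at s u v w b).

Let wb : adj w b. Proof. by case: cut. Qed.
Let ub := cut_end_below cut.

Lemma cut_max : {in [set: G] &, forall x y, d x y <= d u v}.
Proof. by move=> x y _ _; rewrite duv dist_le_diam. Qed.

Lemma below_depth x : d x b < d x w -> d x w <= s.
Proof.
move=> xb; apply: (pendant_depth treeG cut (in_setT u) (in_setT v) cut_max).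
by rewrite !inE.
Qed.

Hypothesis kE : k.+1 = 2 * s.

Lemma below_close x y : d x b < d x w -> d y b < d y w -> close k x y.
Proof.
move=> xb yb; apply: (pendant_clique treeG cut (in_setT u) (in_setT v) cut_max kE);
  by rewrite !inE.
Qed.

(** Seen from outside the part below [w], only the depth matters. *)
Lemma below_twin x : d x b < d x w -> d x w = s -> nbh k u = nbh k x.
Proof.
move=> xb xw; apply/setP => z; rewrite !inE.
have [zw | zb] := side_lt treeG z wb.
  by rewrite (dist_across treeG cut ub zw) (dist_across treeG cut xb zw) xw; case: cut => _ ->.
have := below_close ub zb; have := below_close xb zb; by rewrite /close => -> ->.
Qed.

Hypothesis big : 2 * s <= diam G.

(** The vertex at distance [s] from [w] towards [v] is out of reach of [u], yet
    within reach of every vertex closer than [s] to [w]. *)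
Lemma twin_below x : nbh k u = nbh k x -> d x b < d x w /\ d x w = s.
Proof.
move=> E; case: (cut) => _ duw dub dwv dbv.
have [|z [dwz Ez]] := @dist_point _ connG w v s; first by lia.
have zw : d z w < d z b.
  by have := dist_tri connG z b v; rewrite (dist_sym connG b z) (dist_sym connG z w); lia.
have : ~~ close k x z.
  by rewrite -mem_nbh -E mem_nbh /close (dist_across treeG cut ub zw); lia.
have := nbh_close E; rewrite /close -ltnNge => cux fxz.
have [xw | xb] := side_lt treeG x wb.
  have := dist_across treeG cut ub xw; have := dist_tri connG w x z.
  by rewrite (dist_sym connG x w); lia.
split=> //; have := below_depth xb; have := dist_across treeG cut xb zw; lia.
Qed.

End Cut.

Hypotheses (s_gt0 : 0 < s) (kE : k.+1 = 2 * s) (big : 2 * s <= diam G).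

Lemma twin_peripheral x y : peripheral x -> nbh k x = nbh k y -> peripheral y.
Proof.
move=> /(ecc_diamP connG)[v dxv] E; apply/(ecc_diamP connG); exists v.
have [|w [b cut]] := @cut_exists _ s treeG x v; first by lia.
have [yb yw] := twin_below dxv cut kE big E.
have [wb _ _ dwv dbv] := cut.
by rewrite (dist_across treeG cut yb) ?(dist_sym connG v); lia.
Qed.

(** If [y] were not below [w], or not as deep as [x], then every vertex would be
    closer to [y] than the diameter. *)
Lemma close_twin x y : peripheral x -> peripheral y -> close k x y ->
  nbh k x = nbh k y.
Proof.
move=> /(ecc_diamP connG)[v dxv] /(ecc_diamP connG)[t dyt]; rewrite /close => cxy.
have [|w [b cut]] := @cut_exists _ s treeG x v; first by lia.
have xb := cut_end_below cut; have [wb dxw _ dwv dbv] := cut.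
have side z := side_lt treeG z wb.
have up z : d z w < d z b -> d w z + s <= diam G.
  by move=> zw; have := dist_across treeG cut xb zw; have := dist_le_diam x z; lia.
have low z (zb : d z b < d z w) := below_depth dxv cut zb.
have tri := dist_tri connG w y t.
have [yw | yb] := side y.
  have E := dist_across treeG cut xb yw; rewrite (dist_sym connG y w) in tri.
  have [tw | tb] := side t; first by have := up t tw; lia.
  by have := low t tb; rewrite (dist_sym connG t); lia.
apply: (below_twin dxv cut kE yb).
have [tw | tb] := side t.
  by have := up t tw; have := low y yb; have := dist_across treeG cut yb tw; lia.
by have := below_close dxv cut kE yb tb; rewrite /close; lia.
Qed.

Lemma diametral_twinP x :
  reflect (peripheral x /\ exists2 y, y != x & nbh k y = nbh k x) (diametral_twin k x).
Proof.
rewrite /diametral_twin diametral_leafE; last by lia.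
apply: (iffP andP) => -[px].
  by case/existsP=> y /andP[ny /eqP E]; split=> //; exists y.
by case=> y ny E; split=> //; apply/existsP; exists y; rewrite ny E /=.
Qed.

Lemma no_diametral_twin :
  {in peripheral &, forall x y, x != y -> ~~ close k x y} ->
  forall x, ~~ diametral_twin k x.
Proof.
move=> far x; apply/diametral_twinP => -[px [y ny E]].
have py := twin_peripheral px (esym E).
by have := far y x py px ny; rewrite nbh_close.
Qed.

(** The neighbour [x] of [u] on a diametral path is far from the last two
    vertices of that path; for [s = 1] it would not be in the part cut off. *)
Lemma far_strict : 1 < s -> 2 * s + 2 <= diam G ->
  #|G|.+1 < #|MDIS G k| + #|G|.-1 %/ s.
Proof.
move=> s_gt1 far; have [u [v duv]] := diam_witness connG.
have [|w [b cut]] := @cut_exists _ s treeG u v; first by lia.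
have [wb duw dub dwv dbv] := cut.
have [|x ux dux] := @dist_step _ connG u b; first by lia.
have [|y vy dvy] := @dist_step _ connG v w; first by rewrite (dist_sym connG v w); lia.
have xu : x != u by apply: contraTneq ux => ->; rewrite adj_irrefl.
have vNy : v != y by apply: contraTneq vy => ->; rewrite adj_irrefl.
have t1 := dist_tri connG x u w; have t2 := dist_tri connG x u v.
have t3 := dist_tri connG y x v; rewrite (dist_sym connG y v) (dist_adj connG vy) in t3.
rewrite (dist_adj connG ux) in t1 t2.
apply: (@mis_lower_bound_strict _ _ _ treeG s_gt0 kE u v w b x v y); rewrite ?duv //.
- by lia.
- by rewrite /close (dist_adj connG vy); lia.
- by rewrite /close; lia.
- by rewrite /close; lia.
Qed.

(** The twin of [x] is peripheral, hence far from the last two vertices of a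
    diametral path leaving [x]: their distances are at least [2 * s]. *)
Lemma twin_strict x : 2 * s < diam G -> diametral_twin k x ->
  #|G|.+1 < #|MDIS G k| + #|G|.-1 %/ s.
Proof.
move=> far /diametral_twinP[/(ecc_diamP connG)[v dxv] [y ny E]].
have [|w [b cut]] := @cut_exists _ s treeG x v; first by lia.
have [yb yw] := twin_below dxv cut kE big (esym E).
have [wb dxw dxb dwv dbv] := cut.
have [|z vz dvz] := @dist_step _ connG v w; first by rewrite (dist_sym connG v w); lia.
have vNz : v != z by apply: contraTneq vz => ->; rewrite adj_irrefl.
have dyv : d y v = diam G by rewrite (dist_across treeG cut yb) ?(dist_sym connG v); lia.
have t3 := dist_tri connG z y v; rewrite (dist_sym connG z v) (dist_adj connG vz) in t3.
apply: (@mis_lower_bound_strict _ _ _ treeG s_gt0 kE x v w b y v z); rewrite ?dxv //.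
- by rewrite /close (dist_adj connG vz); lia.
- by rewrite /close; lia.
- by rewrite /close; lia.
Qed.

(** The twin of [x] is far from [y], and therefore also from the twin of [y]. *)
Lemma special_strict x y : special k x y ->
  #|G|.+1 < #|MDIS G k| + #|G|.-1 %/ s.
Proof.
case/and3P=> /diametral_twinP[px [x' nx Ex]] /diametral_twinP[py [y' ny Ey]] nE.
have fxy : ~~ close k x y by apply: contraNN nE => /close_twin->.
have fx'y : ~~ close k x' y by rewrite -mem_nbh Ex mem_nbh.
have fx'y' : ~~ close k x' y'.
  by rewrite (close_sym _ connG) -mem_nbh Ey mem_nbh (close_sym _ connG).
have cyy : close k y y' by rewrite (close_sym _ connG) nbh_close.
have /(ecc_diamP connG)[v dxv] := px.
have [|w [b cut]] := @cut_exists _ s treeG x v; first by lia.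
have [xb _] := twin_below dxv cut kE big (esym Ex).
by apply: (@mis_lower_bound_strict _ _ _ treeG s_gt0 kE x v w b x' y y');
  rewrite ?dxv // eq_sym.
Qed.

(** * The exact count in the two extremal diameters *)

Let e_refl := @close_refl k G.
Let e_sym := @close_sym k G connG.

(** Only vertices at distance [2 * s] are not in conflict, and these are
    peripheral; for peripheral vertices, being close means being twins. Without special pairs, at most one
    vertex [x0] of [J] has twins; then every maximal independent set meets the
    clique formed by the vertices outside [J :\ x0], and the vertex where it
    does so determines it. *)
Lemma card_MDIS_even J u v : diam G = 2 * s -> d u v = diam G ->
    J \in mis (close k) [set: G] -> u \in J -> v \in J ->
    (forall x y, ~~ special k x y) ->
  #|G|.+1 = #|MDIS G k| + #|J|.
Proof.
move=> De duv mJ uJ vJ nsp; rewrite MDIS_mis.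
have farP x y : ~~ close k x y -> peripheral x /\ peripheral y.
  rewrite /close => nc; have := dist_le_diam x y => le.
  by split; apply/(ecc_diamP connG); [exists y | exists x; rewrite dist_sym //]; lia.
have /(misP e_refl e_sym)[/indepP iJ _ domJ] := mJ.
have pJ x : x \in J -> peripheral x.
  move=> xJ; have [xu | nxu] := eqVneq x u.
    by rewrite xu; apply/(ecc_diamP connG); exists v.
  by apply: (farP x u _).1; apply: contraNN nxu => c; rewrite (iJ x u).
have [x0 x0J others] : exists2 x0, x0 \in J
    & forall x y, x \in J -> x != x0 -> nbh k y = nbh k x -> y = x.
  have [/exists_inP[x0 x0J tx0] | /exists_inPn none] :=
      boolP [exists x in J, diametral_twin k x]; [exists x0 | exists u] => // x y xJ nx E;
      apply/eqP; apply: contraT => nyx.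
    have tx : diametral_twin k x by apply/diametral_twinP; split; [exact: pJ | exists y].
    have := nsp x x0; rewrite /special tx tx0 /= negbK => /eqP/nbh_close c.
    by rewrite (iJ x x0) ?eqxx in nx.
  by have /diametral_twinP[] := none x xJ; split; [exact: pJ | exists y].
(* Every peripheral vertex of [C] has the neighbourhood of [x0], for its
   representative in [J] is either [x0] or the vertex itself. *)
pose C := ~: (J :\ x0).
have rep x : peripheral x -> x \in C -> nbh k x = nbh k x0.
  move=> px; rewrite !inE negb_and negbK => xC.
  have [y yJ cxy] := domJ x (in_setT x).
  have E := close_twin px (pJ y yJ) cxy.
  have [<- // | ny] := eqVneq y x0.
  by have xy := others y x yJ ny E; move: xC; rewrite xy (negPf ny) yJ.
have cC : clique (close k) C.
  move=> x y xC yC; apply/idP; apply: contraT => nc; have [px py] := farP x y nc.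
  by rewrite nbh_close ?(rep x) ?(rep y) in nc.
have iC x : x \in C -> indep (close k) [set y in [set: G] | ~~ close k x y].
  move=> xC; apply/indepP => y z; rewrite !inE => fy fz cyz.
  have [px py] := farP _ _ fy; have [_ pz] := farP _ _ fz.
  have Eyz := close_twin py pz cyz; have [j jJ cyj] := domJ y (in_setT y).
  have Ej := close_twin py (pJ j jJ) cyj.
  have [jx0 | nj] := eqVneq j x0.
    by rewrite nbh_close // (rep x) // Ej jx0 in fy.
  by rewrite (others j y) // (others j z) // -Eyz.
have := card_mis_meet1 e_refl e_sym cC (subsetT C) iC.
have -> : [set K in mis (close k) [set: G] | K :&: C != set0] = mis (close k) [set: G].
  apply/setP => K; rewrite inE andb_idr // => /(misP e_refl e_sym)[_ _ dK].
  have [y yK cy] := dK x0 (in_setT x0); apply/set0Pn; exists y; rewrite !inE yK /=.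
  by apply/negP => /andP[ny yJ]; rewrite (iJ x0 y) ?eqxx in ny.
move=> ->; have := cardsC (J :\ x0); have := cardsD1 x0 J; rewrite x0J -/C; lia.
Qed.

Definition periphery : {set G} := [set x | peripheral x].

(** The middle edge of a diametral path is central: a vertex deeper than [s] on
    its side would be too far from the opposite end of the path. *)
Lemma center_edge : diam G = 2 * s + 1 -> exists c1 c2 u v,
  [/\ adj c1 c2, peripheral u /\ peripheral v, d u c1 = s /\ d v c2 = s,
      forall x, d x c1 < d x c2 -> d x c1 <= s ?= iff peripheral x
    & forall x, d x c2 < d x c1 -> d x c2 <= s ?= iff peripheral x].
Proof.
move=> De; have [u [v duv]] := diam_witness connG.
have [|c1 [du E1]] := @dist_point _ connG u v s; first by lia.
have [|c2 a12 dc] := @dist_step _ connG c1 v; first by lia.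
exists c1, c2, u, v.
have dvu : d v u = diam G by rewrite dist_sym.
have [pu pv] : peripheral u /\ peripheral v.
  by split; apply/(ecc_diamP connG); [exists v | exists u].
have a21 : adj c2 c1 by rewrite adj_sym.
have uc : d u c1 < d u c2.
  by have := dist_tri connG c2 u v; lia.
have vc : d v c2 < d v c1 by rewrite !(dist_sym connG v); lia.
have L1 x : d x c1 < d x c2 -> d x c1 <= s.
  by move=> xc; have := dist_cut treeG a12 xc vc; have := dist_le_diam x v; lia.
have L2 x : d x c2 < d x c1 -> d x c2 <= s.
  move=> xc; have := dist_cut treeG a21 xc uc; have := dist_le_diam x u.
  by rewrite (dist_sym connG c1); lia.
have P1 x : d x c1 < d x c2 -> peripheral x -> s <= d x c1.
  move=> xc /(ecc_diamP connG)[t dt]; have [tc | tc] := sideP treeG t a12.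
    have := dist_tri connG c1 x t; have := L1 t; rewrite (dist_sym connG c1); lia.
  have := dist_cut treeG a12 xc (y := t); have := L2 t; rewrite (dist_sym connG c2); lia.
have P2 x : d x c2 < d x c1 -> peripheral x -> s <= d x c2.
  move=> xc /(ecc_diamP connG)[t dt]; have [tc | tc] := sideP treeG t a21.
    have := dist_tri connG c2 x t; have := L2 t; rewrite (dist_sym connG c2); lia.
  have := dist_cut treeG a21 xc (y := t); have := L1 t; rewrite (dist_sym connG c1); lia.
split=> //; first by rewrite (dist_sym connG v c2); lia.
- move=> x xc; split; first exact: L1.
  apply/eqP/idP => [E | px]; last by have := P1 x xc px; have := L1 x xc; lia.
  by apply/(ecc_diamP connG); exists v; rewrite (dist_cut treeG a12 xc vc); lia.
- move=> x xc; split; first exact: L2.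
  apply/eqP/idP => [E | px]; last by have := P2 x xc px; have := L2 x xc; lia.
  apply/(ecc_diamP connG); exists u; rewrite (dist_cut treeG a21 xc uc) (dist_sym connG c1); lia.
Qed.

(** Non-peripheral vertices are pairwise in conflict, and without twins the
    periphery is independent: a maximal independent set is either the whole
    periphery or determined by its unique non-peripheral vertex. *)
Lemma card_MDIS_odd : diam G = 2 * s + 1 -> (forall x, ~~ diametral_twin k x) ->
  #|G|.+1 = #|MDIS G k| + #|periphery|.
Proof.
move=> De ntw; rewrite MDIS_mis.
have [c1 [c2 [u [v [a12 [pu pv] [du dv] L1 L2]]]]] := center_edge De.
have a21 : adj c2 c1 by rewrite adj_sym.
have d12 := dist_adj connG a12; have d21 := dist_adj connG a21.
have side x : d x c1 < d x c2 \/ d x c2 < d x c1 by have := sideP treeG x a12; lia.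
have iP : indep (close k) periphery.
  apply/indepP => x y; rewrite !inE => px py cxy; apply/eqP; apply: contraT => nxy.
  have /diametral_twinP[] := ntw y; split=> //; exists x => //.
  exact: close_twin.
have lt1 x : ~~ peripheral x -> d x c1 < d x c2 -> d x c1 < s.
  by move=> npx xc; have [le eq] := L1 x xc; rewrite ltn_neqAle eq npx.
have lt2 x : ~~ peripheral x -> d x c2 < d x c1 -> d x c2 < s.
  by move=> npx xc; have [le eq] := L2 x xc; rewrite ltn_neqAle eq npx.
have cC : clique (close k) (~: periphery).
  move=> x y; rewrite !inE => npx npy; rewrite /close.
  have := dist_tri connG c1 x y; have := dist_tri connG c2 x y.
  have := dist_tri connG c2 c1 y; have := dist_tri connG c1 c2 y.
  rewrite !(dist_sym connG _ y).
  case: (side x) => hx; case: (side y) => hy.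
  - by have := lt1 x npx hx; have := lt1 y npy hy; lia.
  - by have := lt1 x npx hx; have := lt2 y npy hy; lia.
  - by have := lt2 x npx hx; have := lt1 y npy hy; lia.
  - by have := lt2 x npx hx; have := lt2 y npy hy; lia.
have iC x : x \in ~: periphery -> indep (close k) [set y in [set: G] | ~~ close k x y].
  move=> xC; apply: indepS iP; apply/subsetP => y; rewrite !inE /= => nc.
  by apply: contraNT nc => npy; apply: cC; rewrite // !inE.
have mP : periphery \in mis (close k) [set: G].
  apply/(misP e_refl e_sym); split=> // x _; have [px | npx] := boolP (peripheral x).
    by exists x; rewrite ?inE.
  have [hx | hx] := side x; [exists u | exists v]; rewrite ?inE // /close.
    by have := lt1 x npx hx; have := dist_tri connG c1 x u; rewrite (dist_sym connG c1); lia.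
  by have := lt2 x npx hx; have := dist_tri connG c2 x v; rewrite (dist_sym connG c2); lia.
have := card_mis_meet1 e_refl e_sym cC (subsetT _) iC.
have -> : [set K in mis (close k) [set: G] | K :&: ~: periphery != set0]
    = mis (close k) [set: G] :\ periphery.
  apply/setP => K; rewrite inE in_setD1 andbC.
  have [mK | //] := boolP (K \in mis _ _); last by rewrite !andbF.
  rewrite !andbT; apply/idP/idP => [|nK]; first by apply: contraNneq => ->; rewrite setICr.
  apply: contraNneq nK => K0; rewrite eqEsubset.
  have sK : K \subset periphery by rewrite -setD_eq0 setDE K0.
  rewrite sK /=; apply/subsetP => x xP.
  have /(misP e_refl e_sym)[_ _ dK] := mK; have [y yK cxy] := dK x (in_setT x).
  by rewrite (indepP _ _ iP x y) // (subsetP sK).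
move=> E; have := cardsD1 periphery (mis (close k) [set: G]); rewrite mP.
by have := cardsC periphery; rewrite E => <- ->; rewrite add1n addSn addnC.
Qed.

End Peripheral.

(** * Spiders and double spiders *)

Section LevelTree.
Variables (G : sgraph) (c : G) (lv : G -> nat).
Hypothesis descent : forall x, x != c -> exists2 y, adj x y & lv x = (lv y).+1.

Lemma level_connected : connected G.
Proof.
split=> [|x y]; first by apply/card_gt0P; exists c.
have to_c z : connect (@adj G) z c.
  move: {2}(lv z) (leqnn (lv z)) => m; elim: m z => [|m IHm] z le_z;
    have [-> // | /descent[t zt lt]] := eqVneq z c; first by lia.
  by apply: connect_trans (connect1 zt) (IHm t _); lia.
apply: connect_trans (to_c x) _.
by rewrite (sym_connect_sym (@adj_sym G)).
Qed.

Lemma dist_level x : dist x c <= lv x.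
Proof.
move: {2}(lv x) (leqnn (lv x)) => m; elim: m x => [|m IHm] x le_x;
  have [-> | /descent[t xt lt]] := eqVneq x c; rewrite ?dist_xx //; first by lia.
have := dist_tri level_connected t x c; rewrite (dist_adj level_connected xt).
have := IHm t; lia.
Qed.

(** At a vertex of maximal level on a cycle, the two neighbours along the cycle
    would both be the unique neighbour of lower level. *)
Lemma tree_of_level :
  (forall x y z, adj x y -> adj x z -> lv y <= lv x -> lv z <= lv x -> y = z) ->
  tree G.
Proof.
move=> uniq_down; split; first exact: level_connected.
move=> w cw; rewrite leqNgt; apply/negP => w_gt2.
have [x0 x0w] : exists x0, x0 \in w by case: w w_gt2 {cw} => // a w; exists a; rewrite mem_head.
case: (@arg_maxnP _ x0 [in w] lv x0w) => x xw max.
have [i q Eq] := rot_to xw; have : ucycle (@adj G) (rot i w) by rewrite rot_ucycle.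
have mem y : y \in x :: q -> lv y <= lv x by rewrite -Eq mem_rot => /max.
have : 1 < size q by have := size_rot i w; rewrite Eq /=; lia.
rewrite Eq; case: q mem {Eq} => [|y [|z q]] // mem _.
rewrite /ucycle => /andP[/= /and3P[xy _]]; rewrite rcons_path => /andP[_ zx] /and4P[_ ynq _ _].
have E : y = last z q.
  have xz : adj x (last z q) by rewrite adj_sym.
  apply: (uniq_down x y _ xy xz); apply: mem; first by rewrite !inE eqxx orbT.
  by rewrite 2!in_cons mem_last !orbT.
by rewrite E mem_last in ynq.
Qed.

End LevelTree.

Section SpiderMetric.
Variables p s : nat.
Implicit Types (i : 'I_p) (j : 'I_s).

Definition spider_level (x : S_ p s) : nat := if x is Some (_, j) then j.+1 else 0.

Lemma spider_level_le x : spider_level x <= s.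
Proof. by case: x => [[i j]|] //=; apply: ltn_ord. Qed.

Lemma spider_descent (x : S_ p s) :
  x != None -> exists2 y, adj x y & spider_level x = (spider_level y).+1.
Proof.
case: x => [[i [[|j] lt_j]]|] // _; first by exists None.
by exists (Some (i, Ordinal (ltnW lt_j))); rewrite //= eqxx eqxx orbT.
Qed.

Lemma spider_uniq_down (x y z : S_ p s) : adj x y -> adj x z ->
  spider_level y <= spider_level x -> spider_level z <= spider_level x -> y = z.
Proof.
case: x y z => [[i j]|] [[i1 j1]|] [[i2 j2]|] //=; try by lia.
move=> /andP[/eqP <- h1] /andP[/eqP <- h2] l1 l2; congr (Some (_, _)).
by apply: val_inj => /=; lia.
Qed.

Lemma spider_tree : tree (S_ p s).
Proof. exact: tree_of_level spider_descent spider_uniq_down. Qed.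

Lemma spider_dist_le (x y : S_ p s) : dist x y <= spider_level x + spider_level y.
Proof.
have := dist_tri spider_tree.1 None x y; rewrite (dist_sym spider_tree.1 None y).
have := dist_level spider_descent x; have := dist_level spider_descent y; lia.
Qed.

(** The function that climbs the leg [i] and goes down all the others is
    1-Lipschitz, and drops by [2 * s] between two tips. *)
Lemma spider_dist_tips i i' j j' : i != i' -> j.+1 = s -> j'.+1 = s ->
  dist (Some (i, j) : S_ p s) (Some (i', j')) = 2 * s.
Proof.
move=> ni Ej Ej'; apply/eqP; rewrite eqn_leq; apply/andP; split.
  by apply: leq_trans (spider_dist_le _ _) _; rewrite /= Ej Ej'; lia.
pose g (x : S_ p s) :=
  if x is Some (h, l) then if h == i then s - l.+1 else s + l.+1 else s.
have := @dist_lipschitz _ spider_tree.1 g (Some (i, j)) (Some (i', j')).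
rewrite /g /= eqxx eq_sym (negPf ni) Ej Ej'; rewrite subnn add0n => lip.
have {}lip := lip _; rewrite mul2n -addnn; apply: lip.
move=> [[a l]|] [[a' l']|] //=; last by case: ifP; lia.
  move=> /andP[/eqP <-]; case: ifP; lia.
case: ifP; lia.
Qed.

Lemma spider_diam : 1 < p -> 0 < s -> diam (S_ p s) = 2 * s.
Proof.
move=> p_gt1 s_gt0; apply/eqP; rewrite eqn_leq; apply/andP; split.
  have [x [y <-]] := diam_witness spider_tree.1.
  have := spider_dist_le x y; have := spider_level_le x; have := spider_level_le y; lia.
have lt : s.-1 < s by lia.
rewrite -(@spider_dist_tips (Ordinal (ltnW p_gt1)) (Ordinal p_gt1) (Ordinal lt) (Ordinal lt)) //=;
  [exact: dist_le_diam | lia | lia].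
Qed.

Lemma card_spider : #|S_ p s| = p * s + 1.
Proof. by rewrite card_option card_prod !card_ord addn1. Qed.

Lemma spider_far (x y : S_ p s) :
  spider_level x = s -> spider_level y = s -> 0 < s -> x != y -> dist x y = 2 * s.
Proof.
case: x y => [[i j]|] [[i' j']|] //= Ej Ej'; try by lia.
move=> _ nxy; apply: spider_dist_tips => //; apply: contraNneq nxy => ->.
by have -> : j = j' by apply: val_inj => /=; lia.
Qed.

End SpiderMetric.

Section DoubleSpiderMetric.
Variables p1 p2 s : nat.
Notation B := (B_ p1 p2 s).

Definition dspider_level (x : B) : nat :=
  match x with inl a => spider_level a | inr a => (spider_level a).+1 end.

Lemma dspider_tree : tree B.
Proof.
apply: (@tree_of_level B (inl None) dspider_level).
  move=> [a|a] ne /=.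
    by have [|b ab E] := @spider_descent _ _ a; [apply: contraNneq ne => -> | exists (inl b)].
  have [-> | /spider_descent[b ab E]] := eqVneq a None; first by exists (inl None).
  by exists (inr b); rewrite //= E.
move=> [a|a] [b|b] [c|c] //=.
- by move=> ab ac lb lc; rewrite (spider_uniq_down ab ac).
- by move=> _ /andP[/eqP-> /eqP->].
- by move=> /andP[/eqP-> /eqP->].
- by move=> /andP[/eqP-> /eqP->].
- by move=> /andP[/eqP-> /eqP->] /andP[/eqP-> _].
- by move=> /andP[/eqP-> /eqP->]; case: c => [[i j]|] //=; lia.
- by move=> ab /andP[/eqP Ec /eqP Ea]; rewrite Ea in ab *; case: b ab => [[i j]|] //=; lia.
- by move=> ab ac lb lc; rewrite (spider_uniq_down ab ac).
Qed.

Let connB := dspider_tree.1.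

Lemma dspider_dist_inl (a b : S_ p1 s) : dist (inl a : B) (inl b) = dist a b.
Proof.
by apply: (@hom_isometric _ B inl (spider_tree p1 s) dspider_tree) => // ? ? [].
Qed.

Lemma dspider_dist_inr (a b : S_ p2 s) : dist (inr a : B) (inr b) = dist a b.
Proof.
by apply: (@hom_isometric _ B inr (spider_tree p2 s) dspider_tree) => // ? ? [].
Qed.

Lemma dspider_dist_cross (a : S_ p1 s) (b : S_ p2 s) :
  dist (inl a : B) (inr b) = spider_level a + spider_level b + 1.
Proof.
apply/eqP; rewrite eqn_leq; apply/andP; split.
  have := dist_tri connB (inl None) (inl a) (inr b).
  have := dist_tri connB (inr None) (inl None) (inr b).
  have /(dist_adj connB)-> : adj (inl None : B) (inr None) by [].
  rewrite dspider_dist_inl dspider_dist_inr.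
  have := spider_dist_le a None; have := spider_dist_le None b; rewrite /=; lia.
(* Along the first spider [g] decreases towards its tips, along the second it
   increases. *)
pose g (x : B) := match x with inl a => s - spider_level a | inr a => (s + spider_level a).+1 end.
have := @dist_lipschitz _ connB g (inl a) (inr b); rewrite /g.
have := spider_level_le a; suff lip x y : adj x y -> g y <= (g x).+1 by move=> ? /(_ lip); lia.
have sp q (e f : S_ q s) : adj e f -> spider_level f <= (spider_level e).+1 /\
   spider_level e <= (spider_level f).+1.
  by case: e f => [[i j]|] [[i' j']|] //=; lia.
case: x y => [e|e] [f|f]; rewrite /g.
- by case/sp; lia.
- by case/andP=> /eqP-> /eqP->; rewrite /=; lia.
- by case/andP=> /eqP-> /eqP->; rewrite /=; lia.
- by case/sp; lia.
Qed.

Lemma dspider_diam : 0 < p1 -> 0 < p2 -> 0 < s -> diam B = 2 * s + 1.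
Proof.
move=> p1_gt0 p2_gt0 s_gt0; apply/eqP; rewrite eqn_leq; apply/andP; split.
  have [x [y <-]] := diam_witness connB.
  case: x y => [a|a] [b|b]; rewrite ?(dist_sym connB (inr _) (inl _)) ?dspider_dist_inl ?dspider_dist_inr ?dspider_dist_cross;
    have := spider_dist_le a; have := spider_level_le a; have := spider_level_le b.
  - by move=> ? ? /(_ b); lia.
  - by move=> ? ? _; lia.
  - by move=> ? ? _; lia.
  - by move=> ? ? /(_ b); lia.
have lt : s.-1 < s by lia.
have := dist_le_diam (inl (Some (Ordinal p1_gt0, Ordinal lt)) : B)
                     (inr (Some (Ordinal p2_gt0, Ordinal lt))).
by rewrite dspider_dist_cross /=; lia.
Qed.

Lemma card_dspider : #|B| = (p1 + p2) * s + 2.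
Proof. by rewrite card_sum !card_spider; lia. Qed.

End DoubleSpiderMetric.

Section PendantSpider.
Variables p s r : nat.

(** A spider with [r] further leaves at its centre: with [r < s] these trees
    attain the lower bound for every number of vertices above [2 * s]. *)
Definition pspider_adj : rel (S_ p s + 'I_r)%type := fun x y =>
  match x, y with
  | inl a, inl b => adj a b
  | inl a, inr _ | inr _, inl a => a == None
  | inr _, inr _ => false
  end.

Lemma pspider_adj_sym : symmetric pspider_adj.
Proof. by move=> [a|a] [b|b] //; apply: adj_sym. Qed.

Lemma pspider_adj_irrefl : irreflexive pspider_adj.
Proof. by move=> [a|a] //; apply: adj_irrefl. Qed.

Definition pspider : sgraph := SGraph pspider_adj_sym pspider_adj_irrefl.

Definition pspider_level (x : pspider) : nat :=
  match x with inl a => spider_level a | inr _ => 1 end.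

Lemma pspider_descent (x : pspider) : x != inl None ->
  exists2 y, adj x y & pspider_level x = (pspider_level y).+1.
Proof.
case: x => [a|a] ne /=; last by exists (inl None).
by have [|b ab E] := @spider_descent _ _ a; [apply: contraNneq ne => -> | exists (inl b)].
Qed.

Lemma pspider_tree : tree pspider.
Proof.
apply: (tree_of_level pspider_descent) => -[a|a] [b|b] [c|c] //=.
- by move=> ab ac lb lc; rewrite (spider_uniq_down ab ac).
- by move=> _ /eqP->.
- by move=> /eqP->.
- by move=> /eqP->.
- by move=> /eqP-> /eqP->.
Qed.

Lemma card_pspider : #|pspider| = p * s + 1 + r.
Proof. by rewrite card_sum card_spider card_ord. Qed.

Lemma pspider_dist_inl (a b : S_ p s) : dist (inl a : pspider) (inl b) = dist a b.
Proof.
by apply: (@hom_isometric _ pspider inl (spider_tree p s) pspider_tree) => // ? ? [].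
Qed.

Lemma pspider_dist_le (x y : pspider) : dist x y <= pspider_level x + pspider_level y.
Proof.
have := dist_tri pspider_tree.1 (inl None) x y; rewrite (dist_sym pspider_tree.1 (inl None) y).
have := dist_level pspider_descent x; have := dist_level pspider_descent y; lia.
Qed.

Lemma pspider_diam : 1 < p -> 0 < s -> diam pspider = 2 * s.
Proof.
move=> p_gt1 s_gt0; apply/eqP; rewrite eqn_leq; apply/andP; split.
  have [x [y <-]] := diam_witness pspider_tree.1; apply: leq_trans (pspider_dist_le x y) _.
  have le z : pspider_level z <= s by case: z => [a|a] //=; apply: spider_level_le.
  by have := le x; have := le y; lia.
have [x [y dxy]] := diam_witness (spider_tree p s).1.
by rewrite -(spider_diam p_gt1 s_gt0) -dxy -pspider_dist_inl dist_le_diam.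
Qed.

End PendantSpider.

(** * Embedding spiders in a tree *)

Section Embeddings.
Variables (G : sgraph) (s : nat).
Hypothesis treeG : tree G.
Let connG := treeG.1.
Notation d := (@dist G).

(** Each leg is obtained by walking from [l i] back to [c]; two legs meeting
    outside [c] would make their ends closer than [2 * s - 1]. *)
Lemma spider_embed (c : G) q (l : 'I_q -> G) :
    (forall i, d c (l i) = s) ->
    (forall i i', i != i' -> 2 * s <= (d (l i) (l i')).+1) ->
  exists f : S_ q s -> G, [/\ injective f, hom f, f None = c
    & forall i j, d c (f (Some (i, j))) = j.+1 /\ d (f (Some (i, j))) (l i) + j.+1 = s].
Proof.
move=> dl far.
pose par z := odflt z [pick t | adj z t && (d c z == (d c t).+1)].
have parP z : 0 < d c z -> adj z (par z) /\ d c z = (d c (par z)).+1.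
  move=> dz; rewrite /par; case: pickP => [t /andP[zt /eqP] | none] //=.
  have [|t zt dt] := @dist_step _ connG z c; first by rewrite (dist_sym connG).
  by have := none t; rewrite zt (dist_sym connG c z) (dist_sym connG c t) dt eqxx.
have iterP i m : m <= s -> d c (iter m par (l i)) + m = s /\ d (iter m par (l i)) (l i) <= m.
  elim: m => [|m IHm] le_m; first by rewrite dist_xx dl addn0.
  have [E le] := IHm (ltnW le_m); have [|az dz] := parP (iter m par (l i)); first by lia.
  rewrite iterS; have := dist_tri connG (iter m par (l i)) (par (iter m par (l i))) (l i).
  rewrite (dist_sym connG (par _) (iter _ _ _)) (dist_adj connG az); lia.
pose f (x : S_ q s) := if x is Some (i, j) then iter (s - j.+1) par (l i) else c.
have fP i (j : 'I_s) :
    d c (f (Some (i, j))) = j.+1 /\ d (f (Some (i, j))) (l i) + j.+1 = s.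
  have lt_j := ltn_ord j; have [|E le] := iterP i (s - j.+1); first by lia.
  rewrite /f; have := dist_tri connG (iter (s - j.+1) par (l i)) c (l i); rewrite dl; lia.
have leg i (j j' : 'I_s) : j.+1 = j' -> adj (f (Some (i, j))) (f (Some (i, j'))).
  move=> E; have lt_j := ltn_ord j'; rewrite /f.
  have -> : s - j.+1 = (s - j'.+1).+1 by lia.
  rewrite iterS adj_sym; apply: (parP _ _).1.
  by have [|] := iterP i (s - j'.+1); lia.
have foot i (j : 'I_s) : j == 0 :> nat -> adj c (f (Some (i, j))).
  by move=> /eqP E; rewrite adj_dist // (fP i j).1 E.
exists f; split=> //.
  move=> [[i j]|] [[i' j']|] //; last 2 first.
  - by move=> E; have := (fP i j).1; rewrite E dist_xx.
  - by move=> E; have := (fP i' j').1; rewrite -E dist_xx.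
  move=> E; have [e1 e2] := fP i j; have [e1' e2'] := fP i' j'.
  have Ej : j = j' by apply: ord_inj; move: e1; rewrite E e1' => -[].
  have [-> | ni] := eqVneq i i'; first by rewrite Ej.
  pose F := f (Some (i, j)); have dF : d F (l i) + j.+1 = s := e2.
  have dF' : d F (l i') + j.+1 = s by rewrite /F E Ej.
  have := far i i' ni; have := dist_tri connG F (l i) (l i').
  by rewrite (dist_sym connG (l i) F); clearbody F; lia.
move=> [[i j]|] [[i' j']|] //=; last 2 first.
- by move=> E; rewrite adj_sym; apply: foot.
- exact: foot.
case/andP=> /eqP<- /orP[] /eqP E; first exact: leg.
by rewrite adj_sym; apply: leg.
Qed.

Lemma dspider_embed (c1 c2 : G) p1 p2 (l1 : 'I_p1 -> G) (l2 : 'I_p2 -> G) :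
    adj c1 c2 ->
    (forall i, d c1 (l1 i) = s) -> (forall i, d c2 (l2 i) = s) ->
    (forall i i', i != i' -> 2 * s <= (d (l1 i) (l1 i')).+1) ->
    (forall i i', i != i' -> 2 * s <= (d (l2 i) (l2 i')).+1) ->
    (forall i, d (l1 i) c1 < d (l1 i) c2) -> (forall i, d (l2 i) c2 < d (l2 i) c1) ->
  subgraph (B_ p1 p2 s) G.
Proof.
move=> a12 dl1 dl2 far1 far2 side1 side2; have a21 : adj c2 c1 by rewrite adj_sym.
have [f1 [inj1 hom1 f1c f1P]] := spider_embed dl1 far1.
have [f2 [inj2 hom2 f2c f2P]] := spider_embed dl2 far2.
have d1 := dist_adj connG a12; have d2 := dist_adj connG a21.
have leg1 i (j : 'I_s) : d (f1 (Some (i, j))) c1 < d (f1 (Some (i, j))) c2.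
  have [_] := f1P i j; have [|E] := sideP treeG (f1 (Some (i, j))) a12; first by lia.
  rewrite (dist_sym connG _ (l1 i)) (dist_cut treeG a12 (side1 i)) ?E //.
  by rewrite (dist_sym connG (l1 i)) dl1; lia.
have leg2 i (j : 'I_s) : d (f2 (Some (i, j))) c2 < d (f2 (Some (i, j))) c1.
  have [_] := f2P i j; have [|E] := sideP treeG (f2 (Some (i, j))) a21; first by lia.
  rewrite (dist_sym connG _ (l2 i)) (dist_cut treeG a21 (side2 i)) ?E //.
  by rewrite (dist_sym connG (l2 i)) dl2; lia.
have s1 x : d (f1 x) c1 < d (f1 x) c2.
  by case: x => [[i j]|]; [apply: leg1 | rewrite f1c dist_xx d1].
have s2 x : d (f2 x) c2 < d (f2 x) c1.
  by case: x => [[i j]|]; [apply: leg2 | rewrite f2c dist_xx d2].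
exists (fun x : B_ p1 p2 s => match x with inl a => f1 a | inr a => f2 a end).
  move=> [a|a] [b|b].
  - by move/inj1->.
  - by move=> E; have := s1 a; have := s2 b; rewrite E; lia.
  - by move=> E; have := s1 b; have := s2 a; rewrite E; lia.
  - by move/inj2->.
move=> [a|a] [b|b] /=; try by [apply: hom1 | apply: hom2].
  by case/andP=> /eqP-> /eqP->; rewrite f1c f2c.
by case/andP=> /eqP-> /eqP->; rewrite f1c f2c adj_sym.
Qed.

End Embeddings.

(** * Isomorphic trees *)

Lemma iso_inv (G H : sgraph) : iso G H -> iso H G.
Proof.
case=> f [g fK gK] fa; exists g; first by exists f.
by move=> x y; rewrite -fa !gK.
Qed.

Lemma iso_dist (G H : sgraph) (f : G -> H) : tree G -> tree H ->
  bijective f -> (forall x y, adj (f x) (f y) = adj x y) ->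
  forall x y, dist (f x) (f y) = dist x y.
Proof.
by move=> tG tH /bij_inj f_inj fa; apply: hom_isometric => // x y; rewrite fa.
Qed.

Lemma iso_diam (G H : sgraph) : tree G -> tree H -> iso G H -> diam G = diam H.
Proof.
suff le (G' H' : sgraph) : tree G' -> tree H' -> iso G' H' -> diam G' <= diam H'.
  by move=> tG tH i; have i' := iso_inv i; apply/eqP; rewrite eqn_leq !le.
move=> tG tH [f bf fa]; have [x [y <-]] := diam_witness tG.1.
by rewrite -(iso_dist tG tH bf fa) dist_le_diam.
Qed.

Lemma subgraph_card (G H : sgraph) : subgraph G H -> #|G| <= #|H|.
Proof. by case=> f f_inj _; apply: leq_card f_inj. Qed.

Lemma subgraph_dist (G H : sgraph) : tree G -> tree H -> subgraph G H ->
  exists2 f : G -> H, injective f & forall x y, dist (f x) (f y) = dist x y.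
Proof. by move=> tG tH [f f_inj fa]; exists f => //; apply: hom_isometric. Qed.

Lemma iso_refl (G : sgraph) : iso G G.
Proof. by exists id => //; exists id. Qed.

Lemma tree_iso_spider p s (G : sgraph) : iso G (S_ p s) -> tree G.
Proof.
case=> f bf fa; have [g fK gK] := bf; have f_inj := bij_inj bf.
apply: (@tree_of_level G (g None) (fun x => spider_level (f x))).
  move=> x nx; have [|y xy E] := @spider_descent p s (f x).
    by apply: contraNneq nx => <-; rewrite fK.
  by exists (g y); rewrite -?fa gK.
by move=> x y z xy xz ly lz; apply/f_inj/(@spider_uniq_down _ _ (f x)); rewrite ?fa.
Qed.

(** * Classification of the extremal trees *)

(** All vertices are then in conflict, and the maximal sets are the singletons. *)
Lemma card_MDIS_small (G : sgraph) k :
  connected G -> diam G <= k -> #|MDIS G k| = #|G|.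
Proof.
move=> connG small; have e_refl := @close_refl k G; have e_sym := close_sym k connG.
have cl (x y : G) : close k x y by apply: leq_trans (dist_le_diam x y) small.
have cT : clique (close k) [set: G] by move=> x y _ _.
rewrite MDIS_mis -cardsT -(card_mis_meet1 e_refl e_sym cT (subsetT _)).
  apply: eq_card => J; rewrite [RHS]inE andb_idr // setIT => /(misP e_refl e_sym)[_ _ dom].
  have /card_gt0P[x _] := connG.1; have [y yJ _] := dom x (in_setT x).
  by apply/set0Pn; exists y.
by move=> x _; apply/indepP => y z; rewrite !inE cl.
Qed.

Section Extremal.
Variables (s k : nat).
Hypotheses (s_gt1 : 1 < s) (kE : k.+1 = 2 * s).
Let s_gt0 : 0 < s := ltnW s_gt1.

Lemma no_twin_no_special (G : sgraph) :
  (forall x : G, ~~ diametral_twin k x) -> forall x y : G, ~~ special k x y.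
Proof. by move=> ntw x y; rewrite /special (negPf (ntw x)). Qed.

(** Only tips are peripheral, and distinct tips are far apart. *)
Lemma iso_spider_no_twin p (G : sgraph) : 1 < p -> iso G (S_ p s) ->
  forall x : G, ~~ diametral_twin k x.
Proof.
move=> p_gt1 i; have tG := tree_iso_spider i; have tS := spider_tree p s.
have De := iso_diam tG tS i; have DS := spider_diam p_gt1 s_gt0.
have [f bf fa] := i; have fd := iso_dist tG tS bf fa.
have tip (x : G) : peripheral x -> spider_level (f x) = s.
  move=> /(ecc_diamP tG.1)[y dxy]; have := spider_dist_le (f x) (f y).
  by rewrite fd; have := spider_level_le (f x); have := spider_level_le (f y); lia.
apply: (no_diametral_twin tG s_gt0 kE); first by lia.
move=> x y /tip lx /tip ly nxy; rewrite /close -fd spider_far ?(bij_eq bf) //; lia.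
Qed.

Lemma spider_base p : 1 < p -> base k (S_ p s).
Proof. by move=> p_gt1; split; [exact: spider_tree | exact: iso_spider_no_twin (iso_refl _)]. Qed.

Lemma pspider_no_twin p r : 1 < p -> forall x : pspider p s r, ~~ diametral_twin k x.
Proof.
move=> p_gt1; have tS := pspider_tree p s r; have De := pspider_diam r p_gt1 s_gt0.
have le (x : pspider p s r) : pspider_level x <= s.
  by case: x => [a|a] //=; apply: spider_level_le.
have tip (x : pspider p s r) : peripheral x -> pspider_level x = s.
  move=> /(ecc_diamP tS.1)[y dxy]; have := pspider_dist_le x y.
  by have := le x; have := le y; lia.
apply: (no_diametral_twin tS s_gt0 kE); first by lia.
move=> x y /tip + /tip; case: x y => [a|a] [b|b] //=; try by lia.
by move=> la lb nab; rewrite /close pspider_dist_inl spider_far //; lia.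
Qed.

Lemma dspider_no_twin p1 p2 : 0 < p1 -> 0 < p2 ->
  forall x : B_ p1 p2 s, ~~ diametral_twin k x.
Proof.
move=> p1_gt0 p2_gt0; have tB := dspider_tree p1 p2 s.
have De := dspider_diam p1_gt0 p2_gt0 s_gt0.
pose lv (x : B_ p1 p2 s) := match x with inl a => spider_level a | inr a => spider_level a end.
have le x : lv x <= s by case: x => a; apply: spider_level_le.
have dle (x y : B_ p1 p2 s) : dist x y <= lv x + lv y + 1.
  case: x y => [a|a] [b|b]; rewrite ?(dist_sym tB.1 (inr _) (inl _)) /lv;
    rewrite ?dspider_dist_inl ?dspider_dist_inr ?dspider_dist_cross //.
  - by have := spider_dist_le a b; lia.
  - by lia.
  - by have := spider_dist_le a b; lia.
have tip (x : B_ p1 p2 s) : peripheral x -> lv x = s.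
  move=> /(ecc_diamP tB.1)[y dxy]; have := dle x y.
  by have := le x; have := le y; lia.
apply: (no_diametral_twin tB s_gt0 kE); first by lia.
move=> x y /tip + /tip; case: x y => [a|a] [b|b] /= la lb nab; rewrite /close.
- by rewrite dspider_dist_inl spider_far //; lia.
- by rewrite dspider_dist_cross la lb; lia.
- by rewrite (dist_sym tB.1) dspider_dist_cross la lb; lia.
- by rewrite dspider_dist_inr spider_far //; lia.
Qed.

Lemma dspider_base p1 p2 : 0 < p1 -> 0 < p2 -> base k (B_ p1 p2 s).
Proof. by move=> ? ?; split; [exact: dspider_tree | exact: dspider_no_twin]. Qed.

Section Counting.
Variable G : sgraph.
Hypothesis treeG : tree G.
Let connG := treeG.1.
Notation d := (@dist G).
Let e_refl := @close_refl k G.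
Let e_sym := @close_sym k G connG.

Lemma MDIS_lower_bound : s < #|G| -> #|G| < #|MDIS G k| + #|G|.-1 %/ s.
Proof.
by rewrite MDIS_mis -cardsT => lt; apply: (mis_lower_bound treeG s_gt0 kE (@convexT G)).
Qed.

(** The members of [J] all lie at depth [s] below the centre, in different
    branches. *)
Lemma spider_in_even u v (J : {set G}) : diam G = 2 * s -> d u v = diam G ->
  J \in mis (close k) [set: G] -> u \in J -> v \in J -> subgraph (S_ #|J| s) G.
Proof.
move=> De duv /(misP e_refl e_sym)[/indepP iJ _ _] uJ vJ.
have big : 2 * s <= diam G by rewrite De.
have [|c [b cut]] := @cut_exists _ s treeG u v; first by lia.
have [cb _ _ _ _] := cut.
have depth z : d c z <= s.
  rewrite dist_sym //; have [zb | zc] := sideP treeG z cb.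
    have := dist_across treeG cut (cut_end_below cut) (y := z); have := dist_le_diam u z.
    by have [_ -> _ _ _] := cut; rewrite (dist_sym connG c); lia.
  by apply: (below_depth treeG duv cut); lia.
have far x y : x \in J -> y \in J -> x != y -> 2 * s <= d x y.
  move=> xJ yJ nxy; rewrite leqNgt; apply: contraNN nxy => c'.
  by rewrite (iJ x y) // /close; lia.
have level x : x \in J -> d c x = s.
  move=> xJ; have [y yJ nxy] : exists2 y, y \in J & x != y.
    have [xu | nxu] := eqVneq x u; last by exists u.
    by exists v => //; apply/eqP => E; move: duv; rewrite -E xu dist_xx; lia.
  have := far x y xJ yJ nxy; have := dist_tri connG c x y.
  by have := depth x; have := depth y; rewrite (dist_sym connG x c); lia.
have [|i i' ni|f [f_inj fh _ _]] := @spider_embed G s treeG c #|J| enum_val.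
- by move=> i; apply: level; apply: enum_valP.
- by apply: leqW; apply: far; rewrite ?enum_valP // (inj_eq enum_val_inj).
- by exists f.
Qed.

(** A special pair would improve the bound; without one the exact count makes
    [p] the size of a maximal independent set. *)
Lemma extremal_even p : diam G = 2 * s -> #|MDIS G k| + p = #|G|.+1 ->
    p = #|G|.-1 %/ s ->
  (forall x y : G, ~~ special k x y) /\ subgraph (S_ p s) G.
Proof.
move=> De Em Ep; have big : 2 * s <= diam G by rewrite De.
have nsp (x y : G) : ~~ special k x y.
  by apply/negP => sp; have := special_strict treeG s_gt0 kE big sp; lia.
split=> //; have [u [v duv]] := diam_witness connG.
have nuv : ~~ close k u v by rewrite /close; lia.
have [|J mJ] := mis_ext (indep2 e_sym nuv) (W := [set: G]); first exact: subsetT.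
rewrite subUset !sub1set => /andP[uJ vJ].
have := card_MDIS_even treeG s_gt0 kE big De duv mJ uJ vJ nsp => E.
have <- : #|J| = p by lia.
exact: spider_in_even duv mJ uJ vJ.
Qed.

(** The embedded tips extend to a maximal independent set [J]; it has no further
    member, since [#|J|] legs of length [s] have to fit into [G]. *)
Lemma even_extremal p : 1 < p -> p = #|G|.-1 %/ s -> diam G = 2 * s ->
    (forall x y : G, ~~ special k x y) -> subgraph (S_ p s) G ->
  #|MDIS G k| + p = #|G|.+1.
Proof.
move=> p_gt1 Ep De nsp sub; have big : 2 * s <= diam G by rewrite De.
have [f f_inj fd] := subgraph_dist (spider_tree p s) treeG sub.
have lt : s.-1 < s by lia.
pose tip (i : 'I_p) : S_ p s := Some (i, Ordinal lt).
have dtip i i' : i != i' -> d (f (tip i)) (f (tip i')) = 2 * s.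
  by move=> ni; rewrite fd spider_dist_tips //=; lia.
have tip_inj : injective (f \o tip) by move=> i i' /f_inj[].
have iI : indep (close k) [set f (tip i) | i : 'I_p].
  apply/indepP => _ _ /imsetP[i _ ->] /imsetP[i' _ ->].
  by have [-> // | /dtip] := eqVneq i i'; rewrite /close => -> ; lia.
have [|J mJ sJ] := mis_ext iI (W := [set: G]); first exact: subsetT.
have tJ i : f (tip i) \in J by apply: (subsetP sJ); apply: imset_f.
have duv := dtip (Ordinal (ltnW p_gt1)) (Ordinal p_gt1) isT; rewrite -De in duv.
have := card_MDIS_even treeG s_gt0 kE big De duv mJ (tJ _) (tJ _) nsp.
have := subset_leq_card sJ; rewrite (card_imset _ tip_inj) card_ord.
have := subgraph_card (spider_in_even De duv mJ (tJ _) (tJ _)); rewrite card_spider => cJ.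
have : #|J| <= p by rewrite Ep leq_divRL //; lia.
lia.
Qed.

Lemma periphery_far : 2 * s <= diam G -> (forall x : G, ~~ diametral_twin k x) ->
  forall x y : G, peripheral x -> peripheral y -> x != y -> 2 * s <= d x y.
Proof.
move=> big ntw x y px py nxy; rewrite leqNgt; apply/negP => c.
have /(diametral_twinP treeG s_gt0 kE big)[] := ntw y; split=> //; exists x => //.
by apply: (close_twin treeG s_gt0 kE big); rewrite // /close; lia.
Qed.

(** Both parts of the periphery, split by the central edge, carry a spider. *)
Lemma dspider_in_odd : diam G = 2 * s + 1 -> (forall x : G, ~~ diametral_twin k x) ->
  exists p1 p2, [/\ 0 < p1, 0 < p2, p1 + p2 = #|periphery G| & subgraph (B_ p1 p2 s) G].
Proof.
move=> De ntw; have big : 2 * s <= diam G by lia.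
have far := periphery_far big ntw.
have [c1 [c2 [u [v [a12 [pu pv] [du dv] L1 L2]]]]] := center_edge treeG s_gt0 kE big De.
pose P1 := [set x in periphery G | d x c1 < d x c2].
pose P2 := [set x in periphery G | d x c2 < d x c1].
have P1P x : x \in P1 -> [/\ peripheral x, d x c1 < d x c2 & d c1 x = s].
  rewrite !inE => /andP[px xc]; have [_ E] := L1 x xc; split=> //.
  by apply/eqP; rewrite dist_sym // E.
have P2P x : x \in P2 -> [/\ peripheral x, d x c2 < d x c1 & d c2 x = s].
  rewrite !inE => /andP[px xc]; have [_ E] := L2 x xc; split=> //.
  by apply/eqP; rewrite dist_sym // E.
exists #|P1|, #|P2|; split.
- apply/card_gt0P; exists u; rewrite !inE pu /=.
  have [|uc] := sideP treeG u a12; first by lia.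
  have lt : d u c2 < d u c1 by lia.
  by have [_] := L2 u lt; rewrite pu; lia.
- apply/card_gt0P; exists v; rewrite !inE pv /=.
  have [vc|] := sideP treeG v a12; last by lia.
  have lt : d v c1 < d v c2 by lia.
  by have [_] := L1 v lt; rewrite pv; lia.
- have <- : P1 :|: P2 = periphery G.
    apply/setP => x; rewrite !inE -andb_orr andb_idr // => _.
    by have := sideP treeG x a12; lia.
  rewrite -cardsUI (_ : P1 :&: P2 = set0) ?cards0 ?addn0 //.
  by apply/setP => x; rewrite !inE; apply/negP => /andP[/andP[_ lt1] /andP[_]]; lia.
apply: (@dspider_embed G s treeG c1 c2 #|P1| #|P2| enum_val enum_val a12).
- by move=> i; have [] := P1P _ (enum_valP i).
- by move=> i; have [] := P2P _ (enum_valP i).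
- move=> i i' ni; apply: leqW; apply: far; rewrite ?(inj_eq enum_val_inj) //.
    by have [] := P1P _ (enum_valP i).
  by have [] := P1P _ (enum_valP i').
- move=> i i' ni; apply: leqW; apply: far; rewrite ?(inj_eq enum_val_inj) //.
    by have [] := P2P _ (enum_valP i).
  by have [] := P2P _ (enum_valP i').
- by move=> i; have [] := P1P _ (enum_valP i).
- by move=> i; have [] := P2P _ (enum_valP i).
Qed.

Lemma extremal_odd p : diam G = 2 * s + 1 -> #|MDIS G k| + p = #|G|.+1 ->
    p = #|G|.-1 %/ s ->
  (forall x : G, ~~ diametral_twin k x)
  /\ exists p1 p2, [/\ 0 < p1, 0 < p2, p1 + p2 = p & subgraph (B_ p1 p2 s) G].
Proof.
move=> De Em Ep; have big : 2 * s <= diam G by lia.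
have ntw (x : G) : ~~ diametral_twin k x.
  by apply/negP => tw; have := twin_strict treeG s_gt0 kE big _ tw; lia.
split=> //; have E := card_MDIS_odd treeG s_gt0 kE big De ntw.
have -> : p = #|periphery G| by lia.
exact: dspider_in_odd.
Qed.

(** As in the even case, with the whole periphery in the role of [J]. *)
Lemma odd_extremal p p1 p2 : 0 < p1 -> 0 < p2 -> p1 + p2 = p ->
    p = #|G|.-1 %/ s -> diam G = 2 * s + 1 ->
    (forall x : G, ~~ diametral_twin k x) -> subgraph (B_ p1 p2 s) G ->
  #|MDIS G k| + p = #|G|.+1.
Proof.
move=> p1_gt0 p2_gt0 Epp Ep De ntw sub; have big : 2 * s <= diam G by lia.
have E := card_MDIS_odd treeG s_gt0 kE big De ntw.
have [q1 [q2 [_ _ Eq /subgraph_card]]] := dspider_in_odd De ntw.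
rewrite card_dspider Eq => cP.
have leP : #|periphery G| <= p by rewrite Ep leq_divRL //; lia.
have [f f_inj fd] := subgraph_dist (dspider_tree p1 p2 s) treeG sub.
have lt : s.-1 < s by lia.
pose tip (i : 'I_p1 + 'I_p2) : B_ p1 p2 s :=
  match i with
  | inl i => inl (Some (i, Ordinal lt)) | inr i => inr (Some (i, Ordinal lt))
  end.
have tip_inj : injective (f \o tip) by move=> [i|i] [i'|i'] /f_inj // [->].
have : #|[set (f \o tip) i | i : 'I_p1 + 'I_p2]| <= #|periphery G|.
  apply: subset_leq_card; apply/subsetP => _ /imsetP[i _ ->]; rewrite inE.
  apply/(ecc_diamP connG); rewrite De; case: i => i.
    exists (f (tip (inr (Ordinal p2_gt0)))).
    by rewrite fd dspider_dist_cross /=; lia.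
  exists (f (tip (inl (Ordinal p1_gt0)))).
  by rewrite (dist_sym connG) fd dspider_dist_cross /=; lia.
by rewrite (card_imset _ tip_inj) card_sum !card_ord; lia.
Qed.

Lemma extremal_diam p : 1 < p -> p = #|G|.-1 %/ s -> #|MDIS G k| + p = #|G|.+1 ->
  diam G = 2 * s \/ diam G = 2 * s + 1.
Proof.
move=> p_gt1 Ep Em.
have small : 2 * s <= diam G.
  rewrite leqNgt; apply/negP => lt.
  by have := @card_MDIS_small G k connG; lia.
have : diam G < 2 * s + 2.
  by rewrite ltnNge; apply/negP => far; have := far_strict treeG s_gt0 kE small s_gt1 far; lia.
lia.
Qed.

End Counting.

(** The bound is attained by a spider whose surplus vertices hang at its centre,
    so that minimality means equality. *)
Lemma k_minimal_bound (G : sgraph) p : 2 * s < #|G| -> p = #|G|.-1 %/ s ->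
  k_minimal k G <-> tree G /\ #|MDIS G k| + p = #|G|.+1.
Proof.
move=> big Ep; have p_gt1 : 1 < p by rewrite Ep leq_divRL //; lia.
have bound (H : sgraph) : tree H -> #|H| = #|G| -> #|G| < #|MDIS H k| + p.
  by move=> tH EH; have := MDIS_lower_bound tH; rewrite EH -Ep; apply; lia.
split=> [[tG min] | [tG E]]; last first.
  by split=> // H tH EH; have := bound H tH EH; lia.
split=> //; pose r := #|G|.-1 %% s; pose H := pspider p s r.
have EH : #|H| = #|G| by rewrite card_pspider Ep addnAC -divn_eq; lia.
have tH : tree H := pspider_tree p s r.
have : #|MDIS H k| + p = #|H|.+1.
  apply: (even_extremal tH p_gt1); rewrite ?EH //; first exact: pspider_diam.
    exact/no_twin_no_special/pspider_no_twin.
  by exists inl => // x y [].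
by have := min H tH EH; have := bound G tG erefl; rewrite EH; lia.
Qed.

Definition extends_spider p (G : sgraph) : Prop :=
  [/\ diam G = 2 * s, forall x y : G, ~~ special k x y & subgraph (S_ p s) G].

Definition extends_dspider p (G : sgraph) : Prop :=
  [/\ diam G = 2 * s + 1, forall x : G, ~~ diametral_twin k x
    & exists p1 p2, [/\ 0 < p1, 0 < p2, p1 + p2 = p & subgraph (B_ p1 p2 s) G]].

Lemma k_minimalP (G : sgraph) p : 2 * s < #|G| -> p = #|G|.-1 %/ s ->
  k_minimal k G <-> tree G /\ (extends_spider p G \/ extends_dspider p G).
Proof.
move=> big Ep; have p_gt1 : 1 < p by rewrite Ep leq_divRL //; lia.
rewrite (k_minimal_bound big Ep).
split=> -[tG]; last first.
  case=> [[De nsp sub] | [De ntw [p1 [p2 [p1_gt0 p2_gt0 Epp sub]]]]]; split=> //.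
    exact: even_extremal.
  exact: (odd_extremal tG p1_gt0 p2_gt0 Epp).
move=> Em; split=> //; have [De | De] := extremal_diam tG p_gt1 Ep Em.
  by left; have [] := extremal_even tG De Em Ep.
by right; have [] := extremal_odd tG De Em Ep.
Qed.

End Extremal.

Lemma f_large k n : odd k -> k + 2 <= n -> f_ k n = n - (n - 1) %/ (k %/ 2 + 1) + 1.
Proof. by move=> k_odd big; rewrite /f_ modn2 k_odd leqNgt (_ : _ < n) //; lia. Qed.

Theorem theorem3 (k n : nat) (k_ge3 : 3 <= k) (k_odd : odd k) (n_ge1 : 1 <= n) :
  let s := k %/ 2 + 1 in
  let p := (n - 1) %/ s in
  let r := (n - 1) %% s in
  [/\ forall G : sgraph, #|G| = n -> k_minimal k G -> #|MDIS G k| = f_ k n,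
      n <= k + 1 ->
        forall G : sgraph, tree G -> #|G| = n -> k_minimal k G,
      k + 2 <= n -> s %| n - 1 ->
        forall G : sgraph, #|G| = n /\ k_minimal k G <-> iso G (S_ p s)
    & k + 2 <= n -> ~~ (s %| n - 1) ->
        forall G : sgraph, #|G| = n /\ k_minimal k G <->
          AddStar k (S_ p s) r G \/ Add_class k (B_family p s) (r - 1) G].
Proof.
move=> s p r.
have s_gt1 : 1 < s by rewrite /s; lia.
have s_gt0 := ltnW s_gt1.
have kE : k.+1 = 2 * s by rewrite /s; lia.
have small (G : sgraph) : tree G -> #|G| = n -> n <= k + 1 -> #|MDIS G k| = n.
  move=> tG EG le_n; rewrite -EG; apply: (card_MDIS_small tG.1).
  have [x [y <-]] := diam_witness tG.1; have := dist_ltcard tG.1 x y; lia.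
have En : n - 1 = p * s + r by exact: divn_eq.
have r_lt : r < s by rewrite ltn_mod.
have pE (G : sgraph) : #|G| = n -> p = #|G|.-1 %/ s by move=> ->; rewrite -subn1.
have bigE (G : sgraph) : k + 2 <= n -> #|G| = n -> 2 * s < #|G| by lia.
have p_gt1 : k + 2 <= n -> 1 < p by move=> big; rewrite leq_divRL //; lia.
split.
- move=> G EG [tG min]; have [le_n | gt_n] := leqP n (k + 1).
    by rewrite /f_ -addn1 le_n; apply: small.
  have big : k + 2 <= n by lia.
  have /(k_minimal_bound s_gt1 kE (bigE G big EG) (pE G EG))[_ E] : k_minimal k G by [].
  rewrite f_large // -/s -/p; have : p <= n - 1 by apply: leq_div.
  by lia.
- move=> le_n G tG EG; split=> // H tH EH.
  by rewrite (small G) // (small H) // -EG.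
- move=> big sd G; have Er : r = 0 by apply/eqP.
  split=> [[EG] | i].
    rewrite (k_minimalP s_gt1 kE (bigE G big EG) (pE G EG)) => -[tG].
    (* A double spider would need one vertex more than there are. *)
    case=> [[_ _ sub] | [_ _ [p1 [p2 [_ _ Epp /subgraph_card]]]]]; last first.
      by rewrite card_dspider Epp; lia.
    have tS := spider_tree p s; have [f f_inj fd] := subgraph_dist tS tG sub.
    apply: iso_inv; exists f.
      by apply: inj_card_bij => //; rewrite card_spider; lia.
    by move=> x y; rewrite (adj_dist tG.1) (adj_dist tS.1) fd.
  have tG := tree_iso_spider i; have tS := spider_tree p s.
  have EG : #|G| = n by have [f bf _] := i; rewrite (bij_eq_card bf) card_spider; lia.
  split=> //; rewrite (k_minimalP s_gt1 kE (bigE G big EG) (pE G EG)).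
  split=> //; left; split.
  - by rewrite (iso_diam tG tS i) spider_diam ?p_gt1.
  - apply: no_twin_no_special; apply: (iso_spider_no_twin s_gt1 kE _ i); exact: p_gt1.
  - have [f bf fa] := iso_inv i; exists f; first exact: bij_inj.
    by move=> x y; rewrite fa.
- move=> big nsd G; have r_gt0 : 0 < r by rewrite lt0n.
  have {}p_gt1 := p_gt1 big.
  split=> [[EG] | ].
    rewrite (k_minimalP s_gt1 kE (bigE G big EG) (pE G EG)) => -[tG].
    case=> [[De nsp sub] | [De ntw [p1 [p2 [p1_gt0 p2_gt0 Epp sub]]]]].
      left; split=> //; first exact: spider_base.
      by split; rewrite // ?card_spider ?spider_diam //; lia.
    right; exists (B_ p1 p2 s).
      by exists p1, p2; split=> //; apply: iso_refl.
    split=> //; first exact: dspider_base.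
    by split; rewrite // ?card_dspider ?dspider_diam // ?Epp; lia.
  case=> [[_ [tG EG De sub] nsp] | [T [p1 [p2 [p1_gt0 p2_gt0 Epp i]]]]].
    rewrite card_spider in EG; have {}EG : #|G| = n by lia.
    split=> //; rewrite (k_minimalP s_gt1 kE (bigE G big EG) (pE G EG)).
    by split=> //; left; split=> //; rewrite De spider_diam.
  case=> [[tT _] [tG EG De sub] ntw].
  have ET : #|T| = #|B_ p1 p2 s| by have [f bf _] := i; apply: bij_eq_card bf.
  rewrite ET card_dspider Epp in EG; have {}EG : #|G| = n by lia.
  split=> //; rewrite (k_minimalP s_gt1 kE (bigE G big EG) (pE G EG)).
  split=> //; right; split=> //.
    by rewrite De (iso_diam tT (dspider_tree p1 p2 s) i) dspider_diam.
  exists p1, p2; split=> //; have [f bf fa] := iso_inv i; have [g g_inj gh] := sub.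
  exists (g \o f); first exact: inj_comp g_inj (bij_inj bf).
  by move=> x y xy; apply: gh; rewrite fa.
Qed.
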